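(* Let $\Omega\subset\mathbb{R}^2$ be a bounded open domain. Let $\hat{\mathbf r}=(\hat b,\hat\omega_1,\hat\omega_2)^T$ with $\hat b\in\mathbb{R}$ and $\hat{\boldsymbol\omega}=(\hat\omega_1,\hat\omega_2)^T$, $|\hat{\boldsymbol\omega}|=1$, let $\tilde{\mathbf r}$ be another such vector, and let $\mathbf l_{\hat{\mathbf r}}$ and $\mathbf l_{\tilde{\mathbf r}}$ be two distinct line segments in $\Omega$, with $\mathbf l_{\hat{\mathbf r}}$ non-empty. Let $h(\mathbf x)$ be a function that is continuous, or piecewise continuous with respect to the partition of $\Omega$ by the line segment $\mathbf l_{\tilde{\mathbf r}}$. Then $$\nabla_{\hat{\mathbf r}}\int_\Omega h(\mathbf x)H(\hat{\mathbf r}\cdot\mathbf y)\,d\mathbf x=\int_\Omega h(\mathbf x)\,\delta(\hat{\mathbf r}\cdot\mathbf y)\,\mathbf y\,d\mathbf x=\int_\Omega h(\mathbf x)\,\nabla_{\hat{\mathbf r}}H(\hat{\mathbf r}\cdot\mathbf y)\,d\mathbf x$$ and $$\nabla_{\hat{\mathbf r}}\int_\Omega h(\mathbf x)\,\sigma(\hat{\mathbf r}\cdot\mathbf y)H(\hat{\mathbf r}\cdot\mathbf y)\,d\mathbf x=\int_\Omega h(\mathbf x)\,\sigma(\hat{\mathbf r}\cdot\mathbf y)\,\delta(\hat{\mathbf r}\cdot\mathbf y)\,\mathbf y\,d\mathbf x+\int_\Omega h(\mathbf x)\left[H(\hat{\mathbf r}\cdot\mathbf y)\right]^2\mathbf y\,d\mathbf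 x,$$ where $\nabla_{\hat{\mathbf r}}$ denotes the weak gradient with respect to $\hat{\mathbf r}$.
   Context: For $\mathbf x=(x_1,x_2)^T\in\Omega$, $\mathbf y=(1,x_1,x_2)^T$ denotes the homogeneous coordinates, so $\hat{\mathbf r}\cdot\mathbf y=\hat b+\hat{\boldsymbol\omega}\cdot\mathbf x$. The breaking line of $\hat{\mathbf r}$ is $\mathbf l_{\hat{\mathbf r}}=\{\mathbf x\in\Omega:\hat{\mathbf r}\cdot\mathbf y=0\}$ (similarly $\mathbf l_{\tilde{\mathbf r}}$). $\sigma(t)=\max\{0,t\}$ is the ReLU function; $H$ is the Heaviside function with $H(t)=0$ for $t<0$, $H(0)=1/2$, $H(t)=1$ for $t>0$; $\delta$ is the Dirac delta. In the weak sense, $\sigma'=H$ and $H'=\delta$, so that $\nabla_{\hat{\mathbf r}}H(\hat{\mathbf r}\cdot\mathbf y)=\delta(\hat{\mathbf r}\cdot\mathbf y)\,\mathbf y$. The delta function is understood as the limit $\delta(t)=\lim_{s\to0^+}d_s(t)$, with $d_s(t)=\frac1{2s}$ for $t\in(-s,s)$ and $d_s(t)=0$ otherwise; an integral over $\Omega$ against $\delta(\hat{\mathbf r}\cdot\mathbf y)$ is the limit as $s\to0^+$ of the integral against $d_s(\hat{\mathbf r}\cdot\mathbf y)$; for piecewise continuous integrand $k$ it equals the line integral $\int_{\mathbf l_{\hat{\mathbf r}}}k\,ds$. A weak derivative with respect to a component of $\hat{\mathbf r}$ is taken in the usual distributional sense (testing against $C_0^\infty(\mathbb{R})$ functions of that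 component).
   Formalization: h is assumed bounded (on each piece), so that the integrals exist; the first identity, read between functions of one component of r, is claimed only away from the parameter value r = 0, where it can fail, and in full as distributions; the δ-integral limit is asserted for almost every parameter. *)

(* Defs.v *)
From mathcomp Require Import all_boot all_order all_algebra.
From mathcomp Require Import all_classical all_reals all_analysis.
Import Order.TTheory GRing.Theory Num.Theory.
Import numFieldNormedType.Exports.

Set Implicit Arguments.
Unset Strict Implicit.
Unset Printing Implicit Defensive.

Local Open Scope classical_set_scope.
Local Open Scope ring_scope.

Notation leb1 R := (@lebesgue_measure R).
Notation leb2 R := (@lebesgue_measure R \x @lebesgue_measure R)%E.

Section defs.
Context {R : realType}.

(* Parameter vectors are r = (b, w1, w2)^T, indexed by 'I_3. *)
Definition slope_norm (r : 'cV[R]_3) : R :=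
  Num.sqrt (r (inord 1) 0 ^+ 2 + r (inord 2) 0 ^+ 2).

Definition hcoord (x : R * R) : 'cV[R]_3 :=
  \col_(j < 3) [:: 1; x.1; x.2]`_j.

Definition dot (u v : 'cV[R]_3) : R := (u^T *m v) 0 0.

Definition breaking_line (Omega : set (R * R)) (r : 'cV[R]_3) : set (R * R) :=
  [set x | Omega x /\ dot r (hcoord x) = 0].

(* [subst_comp r i t] is r with component i replaced by t: partial derivatives
   in the i-th component are those of t |-> F (subst_comp r i t). *)
Definition subst_comp (r : 'cV[R]_3) (i : 'I_3) (t : R) : 'cV[R]_3 :=
  \col_(j < 3) (if j == i then t else r j 0).

Definition relu (t : R) : R := Num.max 0 t.

Definition heaviside (t : R) : R :=
  if t < 0 then 0 else if t == 0 then 2^-1 else 1.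

Definition delta_approx (s t : R) : R :=
  if (- s < t) && (t < s) then (2 * s)^-1 else 0.

Definition delta_approx_int (Omega : set (R * R)) (k : R * R -> R)
    (r : 'cV[R]_3) (s : R) : R :=
  \int[leb2 R]_(x in Omega) (k x * delta_approx s (dot r (hcoord x))).

(* v is the integral over Omega of k against delta(r . y). *)
Definition is_delta_int (Omega : set (R * R)) (k : R * R -> R)
    (r : 'cV[R]_3) (v : R) : Prop :=
  delta_approx_int Omega k r s @[s --> 0^'+] --> v.

(* Boundedness stands for the existence of finite one-sided limits at the
   boundary; continuity on an open set alone would not make the integrals
   meaningful. *)
Definition bounded_continuous_on (A : set (R * R)) (h : R * R -> R) : Prop :=
  {within A, continuous h} /\ [bounded h x | x in A].

(* The values on the (null) breaking line itself are unconstrained. *)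
Definition piecewise_continuous_wrt (Omega : set (R * R)) (r : 'cV[R]_3)
    (h : R * R -> R) : Prop :=
  bounded_continuous_on (Omega `&` [set x | dot r (hcoord x) < 0]) h /\
  bounded_continuous_on (Omega `&` [set x | 0 < dot r (hcoord x)]) h.

Definition test_function (U : set R) (phi : R -> R) : Prop :=
  (forall (n : nat) (t : R), derivable (derive1n n phi) t 1) /\
  (exists K : set R, [/\ compact K, K `<=` U &
     forall t, ~ K t -> phi t = 0]).

(* The distributional derivative of F, as a functional of test functions. *)
Definition dist_deriv (F : R -> R) (phi : R -> R) : R :=
  - \int[leb1 R]_(t in setT) (F t * derive1 phi t).

Definition is_weak_deriv (U : set R) (F G : R -> R) : Prop :=
  [/\ locally_integrable U F, locally_integrable U G &
      forall phi, test_function U phi ->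
        dist_deriv F phi = \int[leb1 R]_(t in setT) (G t * phi t)].

(* For r = 0 the argument r . y vanishes identically and delta(r . y) is
   meaningless; at most one value of t is excluded, and none unless both
   components of r other than the i-th are 0. *)
Definition nonzero_params (r : 'cV[R]_3) (i : 'I_3) : set R :=
  [set t | subst_comp r i t != 0].

End defs.

(* Main.v *)
Require Import Defs.
From HB Require Import structures.
From mathcomp Require Import all_boot all_order all_algebra.
From mathcomp Require Import all_classical all_reals all_analysis.
From mathcomp Require Import measurable_realfun.
From mathcomp Require Import ring lra.
Import Order.TTheory GRing.Theory Num.Theory.
Import numFieldNormedType.Exports.
Local Open Scope classical_set_scope.
Local Open Scope ring_scope.

Set Implicit Arguments.
Unset Strict Implicit.
Unset Printing Implicit Defensive.

(** Why the theorem holds.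

    With the component [i] replaced by [t], the argument of the Heaviside function
    at a point [x] is [c x + t * y x], where [y x] is the [i]-th homogeneous
    coordinate of [x].

    The distributional identities hold point by point in [x]. On the line,
    [heaviside (c + t * y)] jumps at [- c / y], so its derivative tested against
    [phi] is [Num.sg y * phi (- c / y)] ([Rintegral_heaviside_derive1]). The
    integral of [y * delta_approx s (c + t * y) * phi t] is [Num.sg y] times the
    mean of [phi] over a shrinking interval around the same point, hence has the
    same limit ([cvg_delta_approx]); if [y = 0] both vanish. For
    [relu * heaviside] one applies the first computation to [(c + t * y) * phi t],
    whose boundary term is 0. Fubini and dominated convergence integrate these
    identities over [x]
    ([dist_deriv_heaviside], [cvg_dist_delta_approx], [dist_deriv_relu]).

    In the second identity the delta term is 0: [relu] is at most [s] on the
    support of [delta_approx s], so the integrand is bounded and tends to 0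
    ([cvg_relu_delta_approx]).

    For the first identity between functions one needs the limit, for almost every
    [t], of averages of [h y] over the strip of half-width [s] around the line
    of parameter [t]. Extended by 0 outside [Omega], whose boundary may have
    positive area, [h] is only a bounded Borel function, so the limit comes from
    Lebesgue's differentiation theorem. It is applied in one coordinate [v],
    transverse to the line, for each value [u] of the other: the strip cuts out an
    interval around a point that depends on [u] and [t]. For fixed [u] this point
    is an affine function of [t], or [- b / t] when the lines stay parallel to an
    axis; both maps pull null sets back to null sets ([ae_affine],
    [ae_inversion]). So for almost every [u] the inner averages converge for
    almost every [t]; Tonelli exchanges the quantifiers and dominated convergence
    integrates over [u] ([ae_cvg_strip_average]). The strip averages are also
    bounded on compact sets of nondegenerate parameters ([delta_limits_ae]), so
    their almost everywhere limit represents the distributional derivative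
    already found ([is_weak_deriv_of_ae_cvg]).

    Finally a piecewise continuous [h] is arbitrary on the breaking line of
    [rtilde], where it need not be measurable; it is replaced by a Borel function
    with the same integrals ([integrand_representative]). *)

(** * Real-valued integrals *)

Section IntegrationTools.
Context d (X : measurableType d) (R : realType).
Variable mu : {measure set X -> \bar R}.

Import HBNNSimple.

(** The integral of a nonnegative function is a supremum over simple functions
    below it, and cutting a simple function off on a null set does not change its
    integral. *)
Lemma le_ge0_integral_off_null (N : set X) (f g : X -> \bar R) :
  measurable N -> mu N = 0%E -> (forall x, 0 <= f x)%E ->
  (forall x, 0 <= g x)%E -> (forall x, ~ N x -> f x = g x) ->
  (\int[mu]_x f x <= \int[mu]_x g x)%E.
Proof.
move=> mN N0 f0 g0 fg; rewrite !ge0_integralTE//.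
apply: ge_ereal_sup => _ [u /= uf <-].
pose v := proj_nnsfun u (measurableC mN).
have -> : sintegral mu u = sintegral mu v.
  have E (w : {nnsfun X >-> R}) :
      sintegral mu w = (\int[mu]_(x in setT) (w x)%:E)%E.
    by rewrite integral_nnsfun// patch_setT.
  rewrite !E; apply: ge0_ae_eq_integral => //.
  - exact/measurable_EFinP.
  - exact/measurable_EFinP.
  - by move=> x _; rewrite lee_fin.
  - by move=> x _; rewrite lee_fin.
  - exists N; split => // x /= /not_implyP[_] nuv; apply: contrapT => nNx.
    by apply: nuv; rewrite /v/= mindicE mem_set// mulr1.
apply: ereal_sup_ubound; exists v => //= x; rewrite mindicE.
have [xN|xN] := boolP (x \in ~` N); rewrite /= ?mulr1 ?mulr0//.
by rewrite -fg//; move: xN; rewrite inE.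
Qed.

(** Neither integrand is assumed measurable: on the null set they may be
    arbitrary. *)
Lemma integral_off_null (N : set X) (f g : X -> \bar R) :
  measurable N -> mu N = 0%E -> (forall x, ~ N x -> f x = g x) ->
  (\int[mu]_x f x = \int[mu]_x g x)%E.
Proof.
move=> mN N0 fg; rewrite integralE [RHS]integralE.
congr (_ - _)%E; apply/eqP; rewrite eq_le; apply/andP; split;
  apply: (le_ge0_integral_off_null mN) => // x /fg; rewrite ?funeposE ?funenegE;
  by move=> ->.
Qed.

Lemma Rintegral_off_null (N : set X) (f g : X -> R) :
  measurable N -> mu N = 0%E -> (forall x, ~ N x -> f x = g x) ->
  \int[mu]_x f x = \int[mu]_x g x.
Proof.
by move=> mN N0 fg; congr fine; apply: (integral_off_null mN) => // x /fg ->.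
Qed.

Lemma ae_imply (P Q : X -> Prop) : (forall x, P x -> Q x) ->
  {ae mu, forall x, P x} -> {ae mu, forall x, Q x}.
Proof. by move=> PQ; apply: filterS. Qed.

Lemma ae_and (P Q : X -> Prop) : {ae mu, forall x, P x} ->
  {ae mu, forall x, Q x} -> {ae mu, forall x, P x /\ Q x}.
Proof. exact: filterS2. Qed.

Lemma integrable_bound (f g : X -> R) : measurable_fun setT f ->
  mu.-integrable setT (EFin \o g) -> (forall x, `|f x| <= g x) ->
  mu.-integrable setT (EFin \o f).
Proof.
move=> mf ig fg; apply: (le_integrable measurableT _ _ ig).
  exact/measurable_EFinP.
by move=> x _ /=; rewrite lee_fin (le_trans (fg x))// ler_norm.
Qed.

Lemma integrable_mul_bounded (g b : X -> R) (M : R) :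
  mu.-integrable setT (EFin \o g) -> measurable_fun setT b ->
  (forall x, `|b x| <= M) -> mu.-integrable setT (EFin \o (fun x => g x * b x)).
Proof.
move=> ig mb bM.
have iM : mu.-integrable setT (EFin \o (fun x => M * `|g x|)).
  by have := integrableZl measurableT M (integrable_norm ig).
apply: (integrable_bound _ iM).
  by apply: measurable_funM => //; apply/measurable_EFinP; case/integrableP: ig.
by move=> x; rewrite normrM mulrC ler_wpM2r.
Qed.

Lemma RintegralN (g : X -> R) : \int[mu]_x (- g x) = - (\int[mu]_x g x).
Proof.
rewrite /Rintegral integralE [in RHS]integralE.
have -> : (fun x => (- g x)%:E)^\+%E = (EFin \o g)^\-%E.
  by rewrite -funeposN; congr funepos; apply/funext.
have -> : (fun x => (- g x)%:E)^\-%E = (EFin \o g)^\+%E.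
  by rewrite -funenegN; congr funeneg; apply/funext.
have : (0 <= \int[mu]_x (EFin \o g)^\+ x)%E by exact: integral_ge0.
have : (0 <= \int[mu]_x (EFin \o g)^\- x)%E by exact: integral_ge0.
case: (\int[mu]_x _)%E => [u||] //; case: (\int[mu]_x _)%E => [v||] //= _ _.
- by rewrite opprB.
- by rewrite oppr0.
- by rewrite oppr0.
- by rewrite oppr0.
Qed.

Lemma Rintegral_dct (D : set X) (u : (X -> R)^nat) (l g : X -> R) :
  measurable D -> (forall n, measurable_fun D (u n)) -> measurable_fun D l ->
  {ae mu, forall x, D x -> u n x @[n --> \oo] --> l x} ->
  mu.-integrable D (EFin \o g) -> (forall n x, D x -> `|u n x| <= g x) ->
  mu.-integrable D (EFin \o l) /\
  \int[mu]_(x in D) u n x @[n --> \oo] --> \int[mu]_(x in D) l x.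
Proof.
move=> mD mu_ ml ul ig ug.
have [|||||il _ cl] := @dominated_convergence _ _ _ mu D mD
  (fun n => EFin \o u n) (EFin \o l) (EFin \o g).
- by move=> n; exact/measurable_EFinP.
- exact/measurable_EFinP.
- apply: filterS ul => x /[apply] ul.
  by apply/fine_cvgP; split; [exact: nearW|exact: ul].
- exact: ig.
- by apply/aeW => x n Dx /=; rewrite lee_fin ug.
split=> //; apply: fine_cvg; rewrite fineK; first exact: cl.
exact: integrable_fin_num.
Qed.

Lemma Rintegral_dct_right (u : R -> X -> R) (l g : X -> R) :
  (forall s, 0 < s -> measurable_fun setT (u s)) -> measurable_fun setT l ->
  (forall x, u s x @[s --> 0^'+] --> l x) ->
  mu.-integrable setT (EFin \o g) -> (forall s x, 0 < s -> `|u s x| <= g x) ->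
  \int[mu]_x u s x @[s --> 0^'+] --> \int[mu]_x l x.
Proof.
move=> mu_ ml ul ig ug; apply/cvg_at_rightP => s [s0 cs].
apply: (proj2 (@Rintegral_dct _ (fun n => u (s n)) l g measurableT _ ml _ ig _)).
- by move=> n; exact: mu_.
- apply: nearW => x _; move: (ul x) => /cvg_at_rightP; apply; split => //.
- by move=> n x _; exact: ug.
Qed.

End IntegrationTools.

Section FubiniTools.
Context d1 d2 (X : measurableType d1) (Y : measurableType d2) (R : realType).
Variable mu : {sigma_finite_measure set X -> \bar R}.
Variable nu : {sigma_finite_measure set Y -> \bar R}.

(** A bound by a product [g x * k y] of integrable functions makes every section
    integrable, not only almost every one, so that the iterated real-valued
    integrals below are all genuine. *)
Lemma integrable_prod_bound (f : X -> Y -> R) (g : X -> R) (k : Y -> R) :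
  measurable_fun setT (fun z => f z.1 z.2) ->
  mu.-integrable setT (EFin \o g) -> nu.-integrable setT (EFin \o k) ->
  (forall x y, `|f x y| <= g x * k y) ->
  (mu \x nu)%E.-integrable setT (fun z => (f z.1 z.2)%:E).
Proof.
move=> mf ig ik fgk; apply/(integrable12ltyP mu nu).
  exact/measurable_EFinP.
have mg : measurable_fun setT g by apply/measurable_EFinP; case/integrableP: ig.
have mk : measurable_fun setT k by apply/measurable_EFinP; case/integrableP: ik.
apply: (@le_lt_trans _ _ (\int[mu]_x ((`|g x|)%:E * \int[nu]_y `|(k y)%:E|))%E).
  apply: ge0_le_integral => //.
  - by move=> x _; exact: integral_ge0.
  - apply: (measurable_fun_fubini_tonelli_F (fun z : X * Y => `|(f z.1 z.2)%:E|)%E) => //.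
    by apply: measurableT_comp => //; exact/measurable_EFinP.
  - apply: emeasurable_funM; last exact: measurable_cst.
    by apply/measurable_EFinP; exact: measurableT_comp.
  move=> x _; rewrite -ge0_integralZl//; last first.
    by apply: measurableT_comp => //; exact/measurable_EFinP.
  apply: ge0_le_integral => //.
  - apply: measurableT_comp => //; apply/measurable_EFinP.
    exact: (measurableT_comp mf (measurable_pair1 _)).
  - apply: emeasurable_funM; first exact: measurable_cst.
    by apply: measurableT_comp => //; exact/measurable_EFinP.
  move=> y _ /=; rewrite lee_fin (le_trans (fgk x y))//.
  by rewrite (le_trans (ler_norm _))// normrM.
rewrite ge0_integralZr//; first last.
- by apply: integral_ge0.
- by apply/measurable_EFinP; exact: measurableT_comp.
case/integrableP: ig => _ ig; case/integrableP: ik => _ ik.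
by apply: lte_mul_pinfty => //; [apply: integral_ge0|rewrite ge0_fin_numE//; exact: integral_ge0].
Qed.

Lemma Rintegral_prod (f : X -> Y -> R) (g : X -> R) (k : Y -> R) :
  measurable_fun setT (fun z => f z.1 z.2) ->
  mu.-integrable setT (EFin \o g) -> nu.-integrable setT (EFin \o k) ->
  (forall x y, `|f x y| <= g x * k y) ->
  \int[(mu \x nu)%E]_z f z.1 z.2 = \int[mu]_x \int[nu]_y f x y.
Proof.
move=> mf ig ik fgk.
have ifz := integrable_prod_bound mf ig ik fgk.
have ikx (c : R) : nu.-integrable setT (EFin \o (fun y => c * k y)).
  by have := integrableZl measurableT c ik.
have i1 x : nu.-integrable setT (EFin \o f x).
  apply: (integrable_bound _ (ikx (g x))) => //.
  exact: (measurableT_comp mf (measurable_pair1 x)).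
rewrite /Rintegral -(integral12_prod_meas1 ifz); congr fine.
apply: eq_integral => x _; rewrite fineK//.
exact: (integrable_fin_num measurableT (i1 x)).
Qed.

Lemma Rfubini (f : X -> Y -> R) (g : X -> R) (k : Y -> R) :
  measurable_fun setT (fun z => f z.1 z.2) ->
  mu.-integrable setT (EFin \o g) -> nu.-integrable setT (EFin \o k) ->
  (forall x y, `|f x y| <= g x * k y) ->
  \int[mu]_x \int[nu]_y f x y = \int[nu]_y \int[mu]_x f x y.
Proof.
move=> mf ig ik fgk; rewrite -(Rintegral_prod mf ig ik fgk).
have ifz := integrable_prod_bound mf ig ik fgk.
have igy (c : R) : mu.-integrable setT (EFin \o (fun x => g x * c)).
  by have := integrableZr measurableT c ig.
have i2 y : mu.-integrable setT (EFin \o (f ^~ y)).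
  apply: (integrable_bound _ (igy (k y))) => //.
  exact: (measurableT_comp mf (measurable_pair2 y)).
rewrite /Rintegral -(integral21_prod_meas1 ifz); congr fine.
apply: eq_integral => y _; rewrite fineK//.
exact: (integrable_fin_num measurableT (i2 y)).
Qed.

Lemma measurable_Rintegral1 (f : X -> Y -> R) :
  measurable_fun setT (fun z => f z.1 z.2) ->
  measurable_fun setT (fun x => \int[nu]_y f x y).
Proof.
move=> mf; apply: measurableT_comp; first exact: fine_measurable.
have mfE : measurable_fun setT (fun z : X * Y => (f z.1 z.2)%:E).
  exact/measurable_EFinP.
rewrite [X in measurable_fun _ X](_ : _ = (fubini_F nu (EFin \o (fun z => f z.1 z.2))^\+
    \- fubini_F nu (EFin \o (fun z => f z.1 z.2))^\-)%E); last first.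
  apply/funext => x; rewrite integralE /fubini_F; congr (_ - _)%E;
  by apply: eq_integral => y _; rewrite ?funeposE ?funenegE.
apply: emeasurable_funB.
- apply: measurable_fun_fubini_tonelli_F => //; exact: measurable_funepos.
- apply: measurable_fun_fubini_tonelli_F => //; exact: measurable_funeneg.
Qed.

(** By Tonelli the exceptional set has measure zero in the product as soon as
    almost all its sections in one direction are null. *)
Lemma ae_swap (P : X -> Y -> Prop) :
  measurable [set z : X * Y | P z.1 z.2] ->
  {ae mu, forall x, {ae nu, forall y, P x y}} ->
  {ae nu, forall y, {ae mu, forall x, P x y}}.
Proof.
move=> mP aeP.
set A := ~` [set z : X * Y | P z.1 z.2].
have mA : measurable A by exact: measurableC.
have E : (\int[mu]_x (nu \o xsection A) x = \int[nu]_y (mu \o ysection A) y)%E.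
  rewrite -(indic_fubini_tonelli_FE nu mA) -(indic_fubini_tonelli_GE mu mA).
  exact: (indic_fubini_tonelli mu nu mA).
have I1 : (\int[mu]_x (nu \o xsection A) x)%E = 0%E.
  rewrite -[RHS](@integral0 _ _ _ mu setT); apply: ae_eq_integral => //.
    exact: measurable_fun_xsection.
  apply: filterS aeP => x aex _ /=.
  apply: (@measure_negligible _ _ _ nu); first exact: measurable_xsection.
  apply: negligibleS aex => y; rewrite /xsection/= inE /A/=.
  by move=> h; exact: h.
move: E; rewrite I1 => /esym I2.
have [N [mN N0 sN]] : {ae nu, forall y, [set: Y] y -> mu (ysection A y) = 0%E}.
  apply/(ae_eq_integral_abs nu measurableT (measurable_fun_ysection mu mA)).
  by rewrite -[RHS]I2; apply: eq_integral => y _ /=; rewrite gee0_abs.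
exists N; split => // y /= nae; apply: sN => /= /(_ I) A0; apply: nae.
exists (ysection A y); split => //; first exact: measurable_ysection.
by move=> x /= nP; rewrite /ysection/= inE.
Qed.

End FubiniTools.

(** * Test functions and the Heaviside function on the line *)

Section CompactSupport.
Context {R : realType}.
Implicit Types (f phi : R -> R) (L : R).

Lemma bounded_of_compact_support f L : continuous f ->
  (forall t, L <= `|t| -> f t = 0) -> exists M, forall t, `|f t| <= M.
Proof.
move=> cf f0.
have : compact [set f x | x in `[- L, L]%classic].
  apply: continuous_compact; last exact: segment_compact.
  exact: continuous_subspaceT.
move=> /compact_bounded[M [_ MB]].
exists (Num.max 0 (M + 1)) => t; have [Lt|tL] := leP L `|t|.
  by rewrite f0// normr0 le_max lexx.
rewrite le_max; apply/orP; right; apply: (MB (M + 1)); first by rewrite ltrDl.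
by exists t => //=; rewrite in_itv/= -ler_norml ltW.
Qed.

Lemma integrable_of_compact_support f L : continuous f ->
  (forall t, L <= `|t| -> f t = 0) -> (leb1 R).-integrable setT (EFin \o f).
Proof.
move=> cf f0.
have : (leb1 R).-integrable `[- L, L]%classic (EFin \o f).
  apply: continuous_compact_integrable; first exact: segment_compact.
  exact: continuous_subspaceT.
move=> iL; have := proj1 (@integrable_mkcond _ _ _ (leb1 R) `[- L, L] _ (measurable_itv _)) iL.
apply: eq_integrable => //.
move=> t _; rewrite patchE; case: ifPn => // /negP tL /=; rewrite f0//.
rewrite leNgt; apply/negP => Lt; apply: tL.
by rewrite inE/= in_itv/= -ler_norml ltW.
Qed.

Lemma continuous_of_derivable f : (forall t, derivable f t 1) -> continuous f.
Proof.
by move=> df t; apply: differentiable_continuous; exact/derivable1_diffP.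
Qed.

Lemma Rintegral_derive1 f a b : a < b -> (forall t, derivable f t 1) ->
  continuous (derive1 f) -> \int[leb1 R]_(t in `[a, b]) derive1 f t = f b - f a.
Proof.
move=> ab df cf'; have cf := continuous_of_derivable df.
have lr : derivable_oo_LRcontinuous f a b.
  by split=> [t _||]; [exact: df|apply: cvg_at_right_filter; exact: cf|
    apply: cvg_at_left_filter; exact: cf].
have eqf : {in `]a, b[, (derive1 f : R -> R) =1 derive1 f} by move=> t _.
have E := continuous_FTC2 ab (continuous_subspaceT cf') lr eqf.
by rewrite /Rintegral E.
Qed.

(** The radius exceeds that of the support by one: then [phi] vanishes near every
    point beyond it, and so does its derivative. *)
Lemma test_function_support phi : test_function setT phi -> exists2 L, 0 < L &
  [/\ forall t, derivable phi t 1, forall t, derivable (derive1 phi) t 1 &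
      forall t, L <= `|t| -> phi t = 0 /\ derive1 phi t = 0].
Proof.
move=> [dphi [K [cK _ K0]]].
have [M [_ MB]] := compact_bounded cK.
have phi0 t : Num.max 0 (M + 1) < `|t| -> phi t = 0.
  rewrite gt_max => /andP[_ Mt]; apply: K0 => Kt.
  have M1 : M < M + 1 by rewrite ltrDl.
  by have /= := MB (M + 1) M1 t Kt; rewrite leNgt Mt.
exists (Num.max 0 (M + 1) + 1); first by rewrite ltr_wpDl// le_max lexx.
split; [exact: (dphi 0%N)|exact: (dphi 1%N)|move=> t].
move=> Lt; have {}Lt : Num.max 0 (M + 1) < `|t|.
  by rewrite (lt_le_trans _ Lt)// ltrDl.
split; first exact: phi0.
rewrite derive1E (@near_eq_derive _ _ _ phi (cst 0) t 1) ?derive_cst//.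
near=> x; apply: phi0; near: x.
have ct : `|x| @[x --> t] --> `|t| by exact: (@norm_continuous R R^o t).
exact: (cvgr_gt _ ct _ Lt).
Unshelve. all: by end_near. Qed.

Lemma measurable_heaviside : measurable_fun setT (@heaviside R).
Proof.
apply: nondecreasing_measurable => // x y xy; rewrite /heaviside.
by case: (ltgtP x 0) => x0; case: (ltgtP y 0) => y0; lra.
Qed.

Lemma measurable_delta_approx s : measurable_fun setT (@delta_approx R s).
Proof.
apply: measurable_fun_ifT => //; apply: measurable_and.
  exact: measurable_fun_ltr.
exact: measurable_fun_ltr.
Qed.

Lemma measurable_relu : measurable_fun setT (@relu R).
Proof. exact: measurable_maxr. Qed.

Lemma heaviside_ge0 (z : R) : 0 <= heaviside z.
Proof. by rewrite /heaviside; case: ifP => // _; case: ifP => // _; lra. Qed.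

Lemma heaviside_le1 (z : R) : heaviside z <= 1.
Proof. by rewrite /heaviside; case: ifP => // _; case: ifP => // _; lra. Qed.

Lemma heavisideN (z : R) : heaviside z = 1 - heaviside (- z).
Proof.
rewrite /heaviside oppr_lt0 oppr_eq0.
by case: (ltgtP z 0) => // _; lra.
Qed.

Lemma heaviside_gt0 (z : R) : 0 < z -> heaviside z = 1.
Proof. by rewrite /heaviside; case: (ltgtP z 0). Qed.

Lemma heaviside_lt0 (z : R) : z < 0 -> heaviside z = 0.
Proof. by rewrite /heaviside; case: (ltgtP z 0). Qed.

Lemma relu_heaviside (z : R) : relu z = heaviside z * z.
Proof.
by rewrite /relu /heaviside; case: (ltgtP z 0) => [z0|z0|->]; rewrite ?mul0r ?mul1r ?mulr0.
Qed.

End CompactSupport.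

Section HeavisideCalculus.
Context {R : realType}.
Variables (Phi : R -> R) (L : R).
Hypothesis dPhi : forall t, derivable Phi t 1.
Hypothesis cPhi' : continuous (derive1 Phi).
Hypothesis Phi0 : forall t, L <= `|t| -> Phi t = 0 /\ derive1 Phi t = 0.

Let iPhi' : (leb1 R).-integrable setT (EFin \o (derive1 Phi)).
Proof. by apply: (@integrable_of_compact_support _ _ L) => // t /Phi0[]. Qed.

Let iH (c y : R) :
  (leb1 R).-integrable setT (EFin \o (fun t => heaviside (c + t * y) * derive1 Phi t)).
Proof.
have iP : (leb1 R).-integrable setT (EFin \o (fun t => `|derive1 Phi t|)).
  exact: integrable_norm.
apply: (integrable_bound _ iP).
  apply: measurable_funM; last exact: continuous_measurable_fun.
  apply: measurableT_comp; first exact: measurable_heaviside.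
  by apply: measurable_funD => //; exact: measurable_funM.
move=> t; rewrite normrM ler_piMl// ger0_norm ?heaviside_ge0//.
exact: heaviside_le1.
Qed.

Let heaviside_gt (c y : R) : 0 < y ->
  \int[leb1 R]_t (heaviside (c + t * y) * derive1 Phi t) = - Phi (- c / y).
Proof.
move=> y0; set p := - c / y.
have zE t : c + t * y = (t - p) * y by rewrite /p; field; exact: lt0r_neq0.
(* beyond B both Phi and its derivative vanish, so the half-line ends there *)
pose B := Num.max p L + 1.
have pM : p <= Num.max p L by rewrite le_max lexx.
have pB : p < B by rewrite /B (le_lt_trans pM)// ltrDl.
have LB : L <= B by rewrite /B ler_wpDr// le_max lexx orbT.
have -> : \int[leb1 R]_t (heaviside (c + t * y) * derive1 Phi t) =
          \int[leb1 R]_t ((derive1 Phi \_ `[p, B]) t).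
  apply: (@Rintegral_off_null _ _ _ (leb1 R) [set p]) => //.
    exact: lebesgue_measure_set1.
  move=> t /eqP tp; rewrite zE patchE mem_setE in_itv/=.
  have [pt|tp'] := ltP p t.
    rewrite heaviside_gt0 ?mulr_gt0 ?subr_gt0// mul1r ltW//=.
    case: leP => // Bt; apply: (proj2 (Phi0 _)).
    by rewrite (le_trans LB)// (le_trans (ltW Bt))// ler_norm.
  have {tp tp'}tp : t < p by rewrite lt_neqAle tp.
  rewrite heaviside_lt0 ?mul0r ?leNgt ?tp//.
  by rewrite pmulr_llt0// subr_lt0.
rewrite -Rintegral_mkcond Rintegral_derive1//.
by rewrite (proj1 (Phi0 _)) ?sub0r// (le_trans LB)// ler_norm.
Qed.

Let Rintegral_derive1_eq0 : \int[leb1 R]_t derive1 Phi t = 0.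
Proof.
(* the half-line starting at - (|L| + 1) contains the whole support *)
have -> : \int[leb1 R]_t derive1 Phi t =
    \int[leb1 R]_t (heaviside ((`|L| + 1) + t * 1) * derive1 Phi t).
  apply: eq_Rintegral => t _; have [Lt|tL] := leP L `|t|.
    by rewrite (proj2 (Phi0 Lt)) mulr0.
  rewrite heaviside_gt0 ?mul1r// mulr1.
  have := ler_norm L; have := ler_norm (- t); rewrite normrN; lra.
rewrite heaviside_gt// divr1 (proj1 (Phi0 _)) ?oppr0//.
by rewrite normrN [leRHS]ger0_norm ?addr_ge0// ler_wpDr// ler_norm.
Qed.

(** Over a half-line the integral of a derivative is a boundary value; the sign
    of [y] says which half-line [0 < c + t * y] is. *)
Lemma Rintegral_heaviside_derive1 (c y : R) :
  \int[leb1 R]_t (heaviside (c + t * y) * derive1 Phi t)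
    = - (Num.sg y * Phi (- c / y)).
Proof.
case: (ltgtP y 0) => [y0|y0|->].
- rewrite ltr0_sg// mulN1r opprK.
  have -> : \int[leb1 R]_t (heaviside (c + t * y) * derive1 Phi t) =
    \int[leb1 R]_t (derive1 Phi t - heaviside (- c + t * - y) * derive1 Phi t).
    apply: eq_Rintegral => t _; rewrite heavisideN mulrBl mul1r.
    by rewrite mulrN -opprD.
  rewrite RintegralB// Rintegral_derive1_eq0 heaviside_gt ?oppr_gt0//.
  by rewrite sub0r opprK invrN mulrNN.
- by rewrite gtr0_sg// mul1r heaviside_gt.
- rewrite sgr0 mul0r oppr0.
  under eq_Rintegral do rewrite mulr0 addr0.
  by rewrite RintegralZl// Rintegral_derive1_eq0 mulr0.
Qed.

End HeavisideCalculus.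

(** * Approximate delta functions as means over small intervals *)

Section DeltaAverages.
Context {R : realType}.
Implicit Types (g : R -> R) (s a q p r M : R).

Lemma delta_approx_ge0 s (z : R) : 0 < s -> 0 <= delta_approx s z.
Proof. by move=> s0; rewrite /delta_approx; case: ifP => // _; rewrite invr_ge0; lra. Qed.

Lemma delta_approx_norm s (z : R) :
  delta_approx s z = if `|z| < s then (2 * s)^-1 else 0.
Proof. by rewrite /delta_approx ltr_norml. Qed.

Lemma in_ball p r (u : R) : (u \in (ball p r : set R)) = (`|p - u| < r).
Proof. by apply/idP/idP; rewrite inE -ball_normE. Qed.

Lemma delta_approx_affine s a q u : 0 < s -> q != 0 ->
  delta_approx s (a + q * u) = (2 * s)^-1 * \1_(ball (- a / q) (s / `|q|)) u.
Proof.
move=> s0 q0; rewrite delta_approx_norm indicE in_ball.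
have -> : a + q * u = - (q * (- a / q - u)) by field.
rewrite normrN normrM ltr_pdivlMr ?normr_gt0// mulrC.
by case: ifP; rewrite ?mulr1 ?mulr0.
Qed.

Lemma Rintegral_delta_approx_ball g s a q : 0 < s -> q != 0 ->
  (leb1 R).-integrable (ball (- a / q) (s / `|q|)) (EFin \o g) ->
  \int[leb1 R]_u (g u * delta_approx s (a + q * u)) =
  (2 * s)^-1 * \int[leb1 R]_(u in ball (- a / q) (s / `|q|)) g u.
Proof.
move=> s0 q0 ig; rewrite -RintegralZl//; last exact: measurable_ball.
rewrite [RHS]Rintegral_mkcond; apply: eq_Rintegral => u _.
rewrite delta_approx_affine// patchE indicE.
by case: ifP => _; rewrite ?mulr1 ?mulr0// mulrC.
Qed.

Lemma integrable_ball_bounded g M p r : measurable_fun setT g ->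
  (forall u, `|g u| <= M) -> (leb1 R).-integrable (ball p r) (EFin \o g).
Proof.
move=> mg gM; apply: measurable_bounded_integrable.
- exact: measurable_ball.
- have [r0|r0] := leP 0 r; first by have := ltry (r *+ 2); rewrite -(lebesgue_measure_ball p r0).
  by rewrite (_ : ball p r = set0) ?measure0 ?ltry//; apply/ball0; exact: ltW.
- exact: measurable_funS mg.
- by exists M; split; [exact: num_real|move=> K MK u _; exact: le_trans (gM u) (ltW MK)].
Qed.

Lemma integrable_delta_approx s a q : 0 < s -> q != 0 ->
  (leb1 R).-integrable setT (EFin \o (fun u => delta_approx s (a + q * u))).
Proof.
move=> s0 q0.
have : (leb1 R).-integrable (ball (- a / q) (s / `|q|)) (EFin \o cst (2 * s)^-1).
  by apply: (@integrable_ball_bounded _ (2 * s)^-1) => // u; rewrite ger0_norm// invr_ge0; lra.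
move=> i; have := proj1 (@integrable_mkcond _ _ _ (leb1 R) _ _ (measurable_ball _ _)) i.
apply: eq_integrable => // u _; rewrite patchE /= delta_approx_affine// indicE.
by case: ifP; rewrite ?mulr1 ?mulr0.
Qed.

Lemma Rintegral_delta_approx s a q : 0 < s -> q != 0 ->
  \int[leb1 R]_u delta_approx s (a + q * u) = `|q|^-1.
Proof.
move=> s0 q0.
under eq_Rintegral do rewrite -[delta_approx _ _]mul1r.
rewrite (@Rintegral_delta_approx_ball (cst 1))//; last first.
  by apply: (@integrable_ball_bounded _ 1) => // u; rewrite normr1.
rewrite Rintegral_cst; last exact: measurable_ball.
have sq : 0 <= s / `|q| by rewrite divr_ge0// ltW.
transitivity ((2 * s)^-1 * (1 * (s / `|q| *+ 2))).
  by congr (_ * (_ * _)); exact: (congr1 fine (lebesgue_measure_ball _ sq)).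
rewrite mul1r -mulr_natl; field.
by rewrite normr_eq0 q0 lt0r_neq0.
Qed.

Lemma integrable_bounded_delta_approx g M s a q : 0 < s -> q != 0 ->
  measurable_fun setT g -> (forall u, `|g u| <= M) ->
  (leb1 R).-integrable setT (EFin \o (fun u => g u * delta_approx s (a + q * u))).
Proof.
move=> s0 q0 mg gM.
have iM : (leb1 R).-integrable setT (EFin \o (fun u => M * delta_approx s (a + q * u))).
  by have := integrableZl measurableT M (integrable_delta_approx a s0 q0).
apply: (integrable_bound _ iM).
  apply: measurable_funM => //; apply: measurableT_comp.
    exact: measurable_delta_approx.
  by apply: measurable_funD => //; exact: measurable_funM.
by move=> u; rewrite normrM [`|delta_approx _ _|]ger0_norm ?delta_approx_ge0//
  ler_wpM2r// delta_approx_ge0.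
Qed.

Lemma Rintegral_delta_approx_le g M s a q : 0 < s -> q != 0 ->
  measurable_fun setT g -> (forall u, `|g u| <= M) ->
  `|\int[leb1 R]_u (g u * delta_approx s (a + q * u))| <= M / `|q|.
Proof.
move=> s0 q0 mg gM.
have ig := integrable_bounded_delta_approx a s0 q0 mg gM.
apply: le_trans (le_normr_Rintegral measurableT ig) _.
rewrite -(Rintegral_delta_approx a s0 q0) -RintegralZl//; last exact: integrable_delta_approx.
apply: le_Rintegral => //.
- exact: integrable_norm.
- by have := integrableZl measurableT M (integrable_delta_approx a s0 q0).
by move=> u _; rewrite normrM [`|delta_approx _ _|]ger0_norm ?delta_approx_ge0//
  ler_wpM2r// delta_approx_ge0.
Qed.

Lemma davg_Rintegral g M p r : 0 < r -> measurable_fun setT g ->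
  (forall u, `|g u| <= M) ->
  davg g p r = ((2 * r)^-1 * \int[leb1 R]_(u in ball p r) `|g u - g p|)%:E.
Proof.
move=> r0 mg gM; rewrite /davg /iavg.
have -> : leb1 R (ball p r) = (r *+ 2)%:E by exact/lebesgue_measure_ball/ltW.
have r2 : r *+ 2 != 0 by rewrite mulrn_eq0 lt0r_neq0.
rewrite inver (negbTE r2) EFinM; congr (_ * _)%E; first by rewrite mulr_natl.
rewrite /Rintegral fineK//; apply: integrable_fin_num; first exact: measurable_ball.
apply: (@integrable_ball_bounded _ (M + M)).
  by apply: measurableT_comp => //; exact: measurable_funB.
by move=> u; rewrite normr_id (le_trans (ler_normB _ _))// lerD.
Qed.

(** The affine change of variable turns the approximate delta into the mean over
    a centred interval shrinking to the zero [- a / q], up to the factor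
    [`|q|^-1]; this is where Lebesgue points enter. *)
Lemma cvg_delta_approx g M a q : q != 0 ->
  measurable_fun setT g -> (forall u, `|g u| <= M) ->
  lebesgue_pt g (- a / q) ->
  \int[leb1 R]_u (g u * delta_approx s (a + q * u)) @[s --> 0^'+]
    --> g (- a / q) / `|q|.
Proof.
move=> q0 mg gM; set p := - a / q => lp.
have nq0 : 0 < `|q| by rewrite normr_gt0.
have mh : measurable_fun setT (fun u => g u - g p) by exact: measurable_funB.
have hM u : `|g u - g p| <= M + M.
  by rewrite (le_trans (ler_normB _ _))// lerD.
have bound s : 0 < s ->
    `|g p / `|q| - \int[leb1 R]_u (g u * delta_approx s (a + q * u))|
    <= `|q|^-1 * fine (davg g p (s / `|q|)).
  move=> s0; rewrite distrC.
  have ig := integrable_bounded_delta_approx a s0 q0 mg gM.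
  have id := integrable_delta_approx a s0 q0.
  have -> : \int[leb1 R]_u (g u * delta_approx s (a + q * u)) - g p / `|q| =
      \int[leb1 R]_u ((g u - g p) * delta_approx s (a + q * u)).
    rewrite -(Rintegral_delta_approx a s0 q0) -RintegralZl// -RintegralB//.
      by apply: eq_Rintegral => u _; rewrite mulrBl.
    by have := integrableZl measurableT (g p) id.
  have ih := integrable_bounded_delta_approx a s0 q0 mh hM.
  apply: le_trans (le_normr_Rintegral measurableT ih) _.
  have -> : \int[leb1 R]_t `|(g t - g p) * delta_approx s (a + q * t)| =
      \int[leb1 R]_t (`|g t - g p| * delta_approx s (a + q * t)).
    by apply: eq_Rintegral => u _; rewrite normrM
      [`|delta_approx _ _|]ger0_norm ?delta_approx_ge0.
  rewrite Rintegral_delta_approx_ball//; last first.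
    apply: (@integrable_ball_bounded _ (M + M)); first exact: measurableT_comp.
    by move=> u; rewrite normr_id.
  rewrite (davg_Rintegral p (divr_gt0 s0 nq0) mg gM) /= mulrA -/p.
  suff -> : (2 * s)^-1 = `|q|^-1 * (2 * (s / `|q|))^-1 by []. field.
  by rewrite normr_eq0 q0 lt0r_neq0.
have lim0 : `|q|^-1 * fine (davg g p (s / `|q|)) @[s --> 0^'+] --> (0 : R).
  rewrite -[X in _ --> X](mulr0 `|q|^-1); apply: cvgMr.
  apply/cvg_at_rightP => u [u0 cu].
  have : fine (davg g p r) @[r --> 0^'+] --> (0 : R) by exact: fine_cvg lp.
  move=> /cvg_at_rightP; apply; split; first by move=> n; rewrite divr_gt0.
  by rewrite -[X in _ --> X](mul0r `|q|^-1); apply: cvgMl.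
apply/cvgrPdist_le => e e0.
near=> s; apply: le_trans (bound s _) _; first by near: s; exact: nbhs_right_gt.
near: s; move/cvgrPdist_le : lim0 => /(_ e e0); apply: filterS => s.
by rewrite sub0r normrN; apply: le_trans; exact: ler_norm.
Unshelve. all: by end_near. Qed.

End DeltaAverages.

(** * Distributional derivatives of parametric integrals *)

Lemma locally_integrable_bounded (R : realType) (U : set R) (F : R -> R) :
  open U -> measurable_fun setT F ->
  (forall K : set R, compact K -> K `<=` U ->
    exists M, forall t, K t -> `|F t| <= M) -> locally_integrable U F.
Proof.
move=> oU mF bF; split => //; first exact: measurable_funS mF.
move=> K KU cK; have [M KM] := bF K cK KU.
have mK : measurable K by exact: compact_measurable.
have : (leb1 R).-integrable K (EFin \o F).
  apply: measurable_bounded_integrable => //.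
  - exact: compact_finite_measure.
  - exact: measurable_funS mF.
  - exists M; split; [exact: num_real|move=> N MN t Kt].
    exact: le_trans (KM t Kt) (ltW MN).
by move=> /integrableP[].
Qed.

(** These identities hold over any sigma-finite measure space [X], with
    [c x + t * y x] as the argument of the Heaviside function at [x]. *)
Section DistributionalIdentities.
Context d (X : measurableType d) (R : realType).
Variable mu : {sigma_finite_measure set X -> \bar R}.
Variables f c y : X -> R.
Hypothesis intf : mu.-integrable setT (EFin \o f).
Hypothesis mc : measurable_fun setT c.
Hypothesis my : measurable_fun setT y.
Hypothesis intfc : mu.-integrable setT (EFin \o (fun x => f x * c x)).
Hypothesis intfy : mu.-integrable setT (EFin \o (fun x => f x * y x)).

Let mf : measurable_fun setT f.
Proof. by apply/measurable_EFinP; case/integrableP: intf. Qed.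

Let z (x : X) (t : R) : R := c x + t * y x.

Let mz : measurable_fun setT (fun p : X * R => z p.1 p.2).
Proof.
apply: measurable_funD; first exact: measurableT_comp.
by apply: measurable_funM => //; exact: measurableT_comp.
Qed.

Let mz1 x : measurable_fun setT (z x).
Proof. by apply: measurable_funD => //; exact: measurable_funM. Qed.

Let mz2 t : measurable_fun setT (z ^~ t).
Proof. by apply: measurable_funD => //; exact: measurable_funM. Qed.

Let iabs (g : X -> R) : mu.-integrable setT (EFin \o g) ->
  mu.-integrable setT (EFin \o (fun x => `|g x|)).
Proof. exact: integrable_norm. Qed.

Lemma integrable_mul_heaviside t :
  mu.-integrable setT (EFin \o (fun x => f x * heaviside (c x + t * y x))).
Proof.
apply: (@integrable_mul_bounded _ _ _ _ _ _ 1) => //.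
  by apply: measurableT_comp; [exact: measurable_heaviside|exact: mz2].
by move=> x; rewrite ger0_norm ?heaviside_ge0 ?heaviside_le1.
Qed.

Let mH : measurable_fun setT (fun p : X * R => heaviside (z p.1 p.2)).
Proof. by apply: measurableT_comp; [exact: measurable_heaviside|]. Qed.

Let normH u : `|heaviside u : R| <= 1.
Proof. by rewrite ger0_norm ?heaviside_ge0 ?heaviside_le1. Qed.

Lemma measurable_relu_dot t : measurable_fun setT (fun x => relu (c x + t * y x)).
Proof. exact: (measurableT_comp measurable_relu (mz2 t)). Qed.

Let mH2 t : measurable_fun setT (fun x => heaviside (z x t)).
Proof. exact: (measurableT_comp measurable_heaviside (mz2 t)). Qed.

Lemma norm_mul_relu_le x t :
  `|f x * relu (c x + t * y x)| <= `|f x * c x| + `|t| * `|f x * y x|.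
Proof.
rewrite relu_heaviside mulrCA normrM.
apply: (@le_trans _ _ `|f x * (c x + t * y x)|); first by rewrite ler_piMl.
by rewrite mulrDr (le_trans (ler_normD _ _))// lerD2l mulrCA normrM.
Qed.

Let icy t : mu.-integrable setT
  (EFin \o (fun x => `|f x * c x| + `|t : R| * `|f x * y x|)).
Proof.
have := integrableZl measurableT `|t : R| (iabs intfy).
by move=> /(integrableD measurableT (iabs intfc)).
Qed.

Lemma integrable_relu_heaviside t : mu.-integrable setT
  (EFin \o (fun x => f x * relu (c x + t * y x) * heaviside (c x + t * y x))).
Proof.
apply: (@integrable_mul_bounded _ _ _ _ _ _ 1); [|exact: mH2|by []].
apply: (integrable_bound _ (icy t)); last by move=> x; exact: norm_mul_relu_le.
by apply: measurable_funM => //; exact: measurable_relu_dot.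
Qed.

Lemma integrable_heaviside2 t : mu.-integrable setT
  (EFin \o (fun x => f x * heaviside (c x + t * y x) ^+ 2 * y x)).
Proof.
have : mu.-integrable setT
    (EFin \o (fun x => f x * y x * heaviside (c x + t * y x) ^+ 2)).
  apply: (@integrable_mul_bounded _ _ _ _ _ _ 1) => //; first by apply: measurable_funX; exact: mH2.
  by move=> x; rewrite normrX expr_le1.
by apply: eq_integrable => // x _ /=; rewrite mulrAC.
Qed.

Section TestFunction.
Variable phi : R -> R.
Hypothesis tphi : test_function setT phi.

Let cphi : continuous phi.
Proof. by have [L _ [d0 _ _]] := test_function_support tphi; exact: continuous_of_derivable. Qed.

Let cphi' : continuous (derive1 phi).
Proof. by have [L _ [_ d1 _]] := test_function_support tphi; exact: continuous_of_derivable. Qed.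

Let mphi : measurable_fun setT phi. Proof. exact: continuous_measurable_fun. Qed.
Let mphi' : measurable_fun setT (derive1 phi).
Proof. exact: continuous_measurable_fun. Qed.

Let iphi : (leb1 R).-integrable setT (EFin \o (fun t => `|phi t|)).
Proof.
have [L _ [_ _ L0]] := test_function_support tphi; apply: integrable_norm => //.
by apply: (@integrable_of_compact_support _ _ L) => // t /L0[].
Qed.

Let iphi' : (leb1 R).-integrable setT (EFin \o (fun t => `|derive1 phi t|)).
Proof.
have [L _ [_ _ L0]] := test_function_support tphi; apply: integrable_norm => //.
by apply: (@integrable_of_compact_support _ _ L) => // t /L0[].
Qed.

Let bphi : exists M, forall t, `|phi t| <= M.
Proof.
have [L _ [_ _ L0]] := test_function_support tphi.
by apply: (@bounded_of_compact_support _ _ L) => // t /L0[].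
Qed.

Let iHphi' x : (leb1 R).-integrable setT
  (EFin \o (fun t => heaviside (z x t) * derive1 phi t)).
Proof.
apply: (integrable_bound _ iphi').
  by apply: measurable_funM => //; exact: (measurableT_comp measurable_heaviside (mz1 x)).
by move=> t; rewrite normrM ler_piMl.
Qed.

(* Measurability in x is read off this form, the limit off the closed form JE. *)
Let J x : R := dist_deriv (fun t => heaviside (z x t)) phi.

Let JE x : J x = Num.sg (y x) * phi (- c x / y x).
Proof.
have [L _ [d0 d1 L0]] := test_function_support tphi.
by rewrite /J /dist_deriv /z (Rintegral_heaviside_derive1 d0 cphi' L0) opprK.
Qed.

Let mJ : measurable_fun setT J.
Proof.
apply: measurableT_comp => //.
apply: (measurable_Rintegral1 (leb1 R) (f := fun x t => heaviside (z x t) * derive1 phi t)).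
by apply: measurable_funM => //; exact: measurableT_comp.
Qed.

(** Fubini moves the distributional derivative inside the integral over [X]. *)
Lemma dist_deriv_heaviside :
  dist_deriv (fun t => \int[mu]_x (f x * heaviside (c x + t * y x))) phi =
  \int[mu]_x (f x * dist_deriv (fun t => heaviside (c x + t * y x)) phi).
Proof.
rewrite {1}/dist_deriv.
transitivity (- \int[leb1 R]_t \int[mu]_x (f x * heaviside (z x t) * derive1 phi t)).
  congr (- _); apply: eq_Rintegral => t _; rewrite -RintegralZr//.
  exact: integrable_mul_heaviside.
rewrite -(@Rfubini _ _ _ _ _ mu (leb1 R) _ (fun x => `|f x|) (fun t => `|derive1 phi t|))//; last 3 first.
- apply: measurable_funM; last exact: measurableT_comp.
  by apply: measurable_funM => //; exact: measurableT_comp.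
- exact: iabs.
- by move=> x t; rewrite !normrM ler_wpM2r// ler_piMr.
have E x : \int[leb1 R]_t (f x * heaviside (z x t) * derive1 phi t) = - (f x * J x).
  rewrite /J /dist_deriv mulrN opprK -RintegralZl//.
  by apply: eq_Rintegral => t _; rewrite mulrA.
under eq_Rintegral do rewrite E.
by rewrite RintegralN opprK.
Qed.

(** After Fubini the inner integral over [t] is [y x] times a mean of [phi] around
    the zero of [c x + t * y x]; its limit is the distributional derivative of the
    jump at that zero. Where [y x] vanishes both are 0. *)
Lemma cvg_dist_delta_approx :
  \int[leb1 R]_t ((\int[mu]_x (f x * y x * delta_approx s (c x + t * y x))) * phi t)
    @[s --> 0^'+] -->
  dist_deriv (fun t => \int[mu]_x (f x * heaviside (c x + t * y x))) phi.
Proof.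
have [M pM] := bphi.
have M0 : 0 <= M by rewrite (le_trans _ (pM 0)).
rewrite dist_deriv_heaviside.
pose u s x := f x * (y x * \int[leb1 R]_t (phi t * delta_approx s (c x + y x * t))).
have uJ x : u s x @[s --> 0^'+] --> f x * J x.
  rewrite /u; apply: cvgMr; rewrite JE.
  have [->|y0] := eqVneq (y x) 0.
    rewrite sgr0 mul0r; under eq_fun do rewrite mul0r; exact: cvg_cst.
  have -> : Num.sg (y x) * phi (- c x / y x) = y x * (phi (- c x / y x) / `|y x|).
    move: (phi _) => w; case: (ltgtP (y x) 0) y0 => // y0 _.
      by rewrite ltr0_sg// ltr0_norm//; field; exact: ltr0_neq0.
    by rewrite gtr0_sg// gtr0_norm//; field; exact: lt0r_neq0.
  apply: cvgMr; apply: (cvg_delta_approx y0 mphi pM).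
  apply: (@continuous_lebesgue_pt _ _ _ setT) => //; last exact: cphi.
  by split => //; exact: openT.
have mdelta s : measurable_fun setT (fun p : X * R => delta_approx s (c p.1 + y p.1 * p.2)).
  apply: measurableT_comp; first exact: measurable_delta_approx.
  apply: measurable_funD; first exact: measurableT_comp.
  by apply: measurable_funM => //; exact: measurableT_comp.
have lim : \int[mu]_x u s x @[s --> 0^'+] --> \int[mu]_x (f x * J x).
  apply: (@Rintegral_dct_right _ _ _ mu u _ (fun x => M * `|f x|)).
  - move=> s s0; apply: measurable_funM => //; apply: measurable_funM => //.
    apply: (measurable_Rintegral1 (leb1 R) (f := fun x t => phi t * delta_approx s (c x + y x * t))).
    by apply: measurable_funM; [exact: measurableT_comp|exact: mdelta].
  - exact: measurable_funM.
  - exact: uJ.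
  - by have := integrableZl measurableT M (iabs intf).
  - move=> s x s0; rewrite /u normrM mulrC ler_wpM2r// normrM.
    have [->|y0] := eqVneq (y x) 0; first by rewrite normr0 mul0r.
    rewrite mulrC -ler_pdivlMr ?normr_gt0//.
    exact: Rintegral_delta_approx_le.
apply: cvg_trans lim; apply: near_eq_cvg; near=> s.
have s0 : 0 < s by near: s; exact: nbhs_right_gt.
have d_le v : `|delta_approx s v| <= (2 * s)^-1 :> R.
  rewrite delta_approx_norm; case: ifP => _; last by rewrite normr0 invr_ge0; lra.
  by rewrite ger0_norm// invr_ge0; lra.
transitivity (\int[mu]_x \int[leb1 R]_t (f x * y x * delta_approx s (c x + t * y x) * phi t)).
  apply: eq_Rintegral => x _; rewrite /u mulrA -RintegralZl//.
    by apply: eq_Rintegral => t _; rewrite [y x * t]mulrC; ring.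
  have ik : (leb1 R).-integrable setT (EFin \o (fun t => (2 * s)^-1 * `|phi t|)).
    by have := integrableZl measurableT (2 * s)^-1 iphi.
  apply: (integrable_bound _ ik); last by move=> t; rewrite normrM mulrC ler_wpM2r.
  by apply: measurable_funM => //; exact: (measurableT_comp (mdelta s) (measurable_pair1 x)).
have ik : (leb1 R).-integrable setT (EFin \o (fun t => (2 * s)^-1 * `|phi t|)).
  by have := integrableZl measurableT (2 * s)^-1 iphi.
rewrite (@Rfubini _ _ _ _ _ mu (leb1 R) _ (fun x => `|f x * y x|)
  (fun t => (2 * s)^-1 * `|phi t|))//; last 3 first.
- apply: measurable_funM; last exact: measurableT_comp.
  apply: measurable_funM.
    by apply: (measurableT_comp (f := fun x => f x * y x)) => //; exact: measurable_funM.
  by apply: measurableT_comp; [exact: measurable_delta_approx|exact: mz].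
- exact: iabs.
- by move=> x t; rewrite normrM [in leLHS]normrM -mulrA ler_wpM2l// ler_wpM2r.
apply: eq_Rintegral => t _; rewrite RintegralZr//.
apply: (@integrable_mul_bounded _ _ _ _ _ _ (2 * s)^-1) => //.
by apply: measurableT_comp; [exact: measurable_delta_approx|exact: mz2].
Unshelve. all: by end_near. Qed.

Let reluH (u : R) : relu u * heaviside u = heaviside u * u.
Proof.
rewrite relu_heaviside; case: (ltgtP u 0) => [u0|u0|->].
- by rewrite heaviside_lt0// !mul0r.
- by rewrite heaviside_gt0// !mul1r mulr1.
- by rewrite !mulr0 mul0r.
Qed.

(** The product rule turns [relu * heaviside] into a boundary term: the function
    [(c + t * y) * phi t] vanishes at the zero of [c + t * y]. *)
Let dist_deriv_relu1 (c0 y0 : R) :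
  dist_deriv (fun t => relu (c0 + t * y0) * heaviside (c0 + t * y0)) phi =
  \int[leb1 R]_t (heaviside (c0 + t * y0) ^+ 2 * y0 * phi t).
Proof.
have [L _ [d0 d1 L0]] := test_function_support tphi.
have [->|yn0] := eqVneq y0 0.
  have -> : \int[leb1 R]_t (heaviside (c0 + t * 0) ^+ 2 * 0 * phi t) =
            \int[leb1 R]_t (cst 0 t).
    by apply: eq_Rintegral => t _; rewrite mulr0 mul0r.
  rewrite Rintegral_cst// mul0r /dist_deriv.
  have -> : \int[leb1 R]_t (relu (c0 + t * 0) * heaviside (c0 + t * 0) * derive1 phi t)
      = \int[leb1 R]_t (relu c0 * (heaviside (c0 + t * 0) * derive1 phi t)).
    by apply: eq_Rintegral => t _; rewrite mulr0 addr0 mulrA.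
  have iHp : (leb1 R).-integrable setT
      (EFin \o (fun t => heaviside (c0 + t * 0) * derive1 phi t)).
    apply: (integrable_bound _ iphi').
      apply: measurable_funM => //; apply: (measurableT_comp measurable_heaviside).
      by apply: measurable_funD => //; exact: measurable_funM.
    by move=> t; rewrite normrM ler_piMl.
  rewrite RintegralZl// (Rintegral_heaviside_derive1 d0 cphi' L0).
  by rewrite sgr0 mul0r oppr0 mulr0 oppr0.
(* Phi = (c0 + t * y0) * phi is the function whose boundary term vanishes *)
pose a t : R := c0 + t * y0.
have da t : is_derive t (1 : R) a y0.
  have -> : a = cst c0 + id * cst y0 by exact/funext.
  have h := is_deriveD (is_derive_cst c0 t 1)
    (is_deriveM (is_derive_id t 1) (is_derive_cst y0 t 1)).
  by apply: (is_derive_eq h); rewrite scaler0 !add0r; exact: mulr1.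
pose Phi t := a t * phi t.
have dPhi t : is_derive t (1 : R) Phi (a t * derive1 phi t + phi t * y0).
  have dp : is_derive t (1 : R) phi (derive1 phi t).
    by split; [exact: d0|rewrite derive1E].
  have -> : Phi = a * phi by exact/funext.
  exact: is_deriveM.
have Phi'E : derive1 Phi = (fun t => a t * derive1 phi t + phi t * y0).
  by apply/funext => t; rewrite derive1E; exact: derive_val.
have ca : continuous a by apply: continuous_of_derivable => t; case: (da t).
have cPhi' : continuous (derive1 Phi).
  rewrite Phi'E => t; apply: cvgD; first by apply: cvgM; [exact: ca|exact: cphi'].
  by apply: cvgMl; exact: cphi.
have LP t : L <= `|t| -> Phi t = 0 /\ derive1 Phi t = 0.
  by move=> /L0[p0 p1]; rewrite Phi'E /Phi p0 p1 !mulr0 mul0r addr0.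
have dP t : derivable Phi t 1 by case: (dPhi t).
have := Rintegral_heaviside_derive1 dP cPhi' LP c0 y0.
have -> : Phi (- c0 / y0) = 0.
  by rewrite /Phi /a mulfVK// addrN mul0r.
rewrite mulr0 oppr0 Phi'E.
have ma : measurable_fun setT a by exact: continuous_measurable_fun.
have mHa : measurable_fun setT (fun t => heaviside (a t) : R).
  exact: (measurableT_comp measurable_heaviside ma).
have i1 : (leb1 R).-integrable setT (EFin \o (fun t => heaviside (a t) * (a t * derive1 phi t))).
  have iap : (leb1 R).-integrable setT (EFin \o (fun t => a t * derive1 phi t)).
    apply: (@integrable_of_compact_support _ _ L).
      by move=> t; apply: cvgM; [exact: ca|exact: cphi'].
    by move=> t /L0[_ ->]; rewrite mulr0.
  have := integrable_mul_bounded iap mHa (fun t => normH (a t)).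
  by apply: eq_integrable => // t _ /=; rewrite mulrC.
have i2 : (leb1 R).-integrable setT (EFin \o (fun t => heaviside (a t) * (phi t * y0))).
  have iap : (leb1 R).-integrable setT (EFin \o (fun t => phi t * y0)).
    apply: (@integrable_of_compact_support _ _ L).
      by move=> t; apply: cvgMl; exact: cphi.
    by move=> t /L0[-> _]; rewrite mul0r.
  have := integrable_mul_bounded iap mHa (fun t => normH (a t)).
  by apply: eq_integrable => // t _ /=; rewrite mulrC.
under eq_Rintegral do rewrite mulrDr.
rewrite RintegralD// => /eqP; rewrite addr_eq0 => /eqP E.
rewrite /dist_deriv.
under eq_Rintegral do rewrite reluH -mulrA.
rewrite E opprK.
apply: (@Rintegral_off_null _ _ _ (leb1 R) [set - c0 / y0]) => //.
  exact: lebesgue_measure_set1.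
move=> t tp; suff -> : heaviside (a t) ^+ 2 = heaviside (a t) by ring.
case: (ltgtP (a t) 0) => [u0|u0|u0].
- by rewrite heaviside_lt0// expr0n.
- by rewrite heaviside_gt0// expr1n.
- exfalso; apply: tp; rewrite /= -[LHS](mulfK yn0); congr (_ / _).
  by move: u0; rewrite /a; lra.
Qed.

(** Fubini reduces the identity to one point [x]; the factor [1 + L] of the
    dominating function comes from [`|t| <= L] on the support of [phi]. *)
Lemma dist_deriv_relu :
  dist_deriv (fun t => \int[mu]_x
    (f x * relu (c x + t * y x) * heaviside (c x + t * y x))) phi =
  \int[leb1 R]_t ((\int[mu]_x (f x * heaviside (c x + t * y x) ^+ 2 * y x)) * phi t).
Proof.
have [L L_gt0 [d0 d1 L0]] := test_function_support tphi.
have if1 t : mu.-integrable setT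
    (EFin \o (fun x => f x * relu (z x t) * heaviside (z x t))).
  exact: integrable_relu_heaviside.
have if2 t : mu.-integrable setT (EFin \o (fun x => f x * heaviside (z x t) ^+ 2 * y x)).
  exact: integrable_heaviside2.
rewrite /dist_deriv.
transitivity (- \int[leb1 R]_t \int[mu]_x
    (f x * relu (z x t) * heaviside (z x t) * derive1 phi t)).
  by congr (- _); apply: eq_Rintegral => t _; rewrite -RintegralZr//; exact: if1.
transitivity (\int[leb1 R]_t \int[mu]_x
    (f x * heaviside (z x t) ^+ 2 * y x * phi t)); last first.
  by apply: eq_Rintegral => t _; rewrite -RintegralZr//; exact: if2.
have icy1 : mu.-integrable setT (EFin \o (fun x => `|f x * c x| + `|f x * y x|)).
  by have := integrableD measurableT (iabs intfc) (iabs intfy).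
have ik : (leb1 R).-integrable setT (EFin \o (fun t => (1 + L) * `|derive1 phi t|)).
  by have := integrableZl measurableT (1 + L) iphi'.
have mf1 : measurable_fun setT (fun p : X * R => f p.1) by exact: measurableT_comp.
rewrite -(@Rfubini _ _ _ _ _ mu (leb1 R) _ _ _ _ icy1 ik)//; last 2 first.
- apply: measurable_funM; last exact: measurableT_comp.
  apply: measurable_funM => //; apply: measurable_funM => //.
  exact: (measurableT_comp measurable_relu mz).
- move=> x t; have [Lt|tL] := leP L `|t|.
    by rewrite (proj2 (L0 _ Lt)) mulr0 normr0 mulr0.
  have arith (A B T l : R) : 0 <= A -> 0 <= B -> 0 <= l -> T <= l ->
    A + T * B <= (A + B) * (1 + l) by move=> *; nra.
  rewrite normrM mulrA ler_wpM2r// normrM.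
  rewrite (le_trans (ler_piMr _ (normH _)))// (le_trans (norm_mul_relu_le x t))//.
  by apply: arith => //; exact: ltW.
rewrite -(@Rfubini _ _ _ _ _ mu (leb1 R) _ _ _ _ (iabs intfy) iphi)//; last 2 first.
- apply: measurable_funM; last exact: measurableT_comp.
  apply: measurable_funM; last exact: measurableT_comp.
  by apply: measurable_funM => //; exact: measurable_funX.
- move=> x t; rewrite normrM ler_wpM2r// mulrAC normrM ler_piMr//.
  by rewrite normrX expr_le1.
rewrite -RintegralN; apply: eq_Rintegral => x _.
transitivity (f x * dist_deriv (fun t => relu (z x t) * heaviside (z x t)) phi).
  rewrite /dist_deriv mulrN -RintegralZl//.
    by congr (- _); apply: eq_Rintegral => t _; rewrite !mulrA.
  have iz : (leb1 R).-integrable setT (EFin \o (fun t => z x t * derive1 phi t)).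
    apply: (@integrable_of_compact_support _ _ L); last by move=> t /L0[_ ->]; rewrite mulr0.
    move=> t; apply: cvgM; last exact: cphi'.
    by apply: cvgD; [exact: cvg_cst|apply: cvgMl; exact: cvg_id].
  have := integrable_mul_bounded iz (measurableT_comp measurable_heaviside (mz1 x)) (fun t => normH (z x t)).
  by apply: eq_integrable => // t _ /=; rewrite reluH; congr EFin; ring.
rewrite dist_deriv_relu1 -RintegralZl//.
  by apply: eq_Rintegral => t _; rewrite !mulrA.
have ip : (leb1 R).-integrable setT (EFin \o (fun t => `|y x| * `|phi t|)).
  by have := integrableZl measurableT `|y x| iphi.
apply: (integrable_bound _ ip).
  apply: measurable_funM => //; apply: measurable_funM => //; apply: measurable_funX.
  exact: (measurableT_comp measurable_heaviside (mz1 x)).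
by move=> t; rewrite normrM ler_wpM2r// normrM ler_piMl// normrX expr_le1.
Qed.

End TestFunction.
(** Where [delta_approx s] does not vanish, [relu] is at most [s]: the product is
    bounded by 1/2 and tends to 0 at every point. *)
Lemma cvg_relu_delta_approx t :
  \int[mu]_x (f x * relu (c x + t * y x) * y x * delta_approx s (c x + t * y x))
    @[s --> 0^'+] --> (0 : R).
Proof.
have i2 : mu.-integrable setT (EFin \o (fun x => 2^-1 * `|f x * y x|)).
  by have := integrableZl measurableT 2^-1 (iabs intfy).
have := @Rintegral_dct_right _ _ _ mu (fun s x =>
  f x * relu (z x t) * y x * delta_approx s (z x t)) (cst 0) _ _ _ _ i2.
rewrite Rintegral_cst// mul0r; apply.
- move=> s s0; apply: measurable_funM.
    by apply: measurable_funM => //; apply: measurable_funM => //; exact: measurable_relu_dot.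
  exact: (measurableT_comp (measurable_delta_approx s) (mz2 t)).
- exact: measurable_cst.
- move=> x; have [zn|zp] := leP (z x t) 0.
    rewrite /relu max_l//; under eq_fun do rewrite mulr0 !mul0r; exact: cvg_cst.
  apply: (@cvg_trans _ ((fun=> 0 : R) @ 0^'+)); last exact: cvg_cst.
  apply: near_eq_cvg; near=> s.
  have sz : s < z x t by near: s; exact: nbhs_right_lt.
  by rewrite delta_approx_norm gtr0_norm// ltNge (ltW sz)/= mulr0.
- move=> s x s0.
  have -> : f x * relu (z x t) * y x * delta_approx s (z x t) =
    (relu (z x t) * delta_approx s (z x t)) * (f x * y x) by ring.
  rewrite normrM ler_wpM2r// delta_approx_norm.
  case: ifPn => [zs|_]; last by rewrite mulr0 normr0; lra.
  have r0 : 0 <= relu (z x t) by rewrite /relu le_max lexx.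
  have rs : relu (z x t) <= s.
    by rewrite /relu ge_max (ltW s0) ltW// (le_lt_trans (ler_norm _) zs).
  rewrite ger0_norm; last by rewrite mulr_ge0// invr_ge0; lra.
  rewrite ler_pdivrMr; last by lra.
  by rewrite mulrA mulVf ?mul1r//; lra.
Unshelve. all: by end_near. Qed.

Let mz' : measurable_fun setT (fun p : R * X => z p.2 p.1).
Proof.
apply: measurable_funD; first exact: measurableT_comp.
by apply: measurable_funM => //; exact: measurableT_comp.
Qed.

Let mf2 (g : X -> R) : measurable_fun setT g -> measurable_fun setT (fun p : R * X => g p.2).
Proof. by move=> mg; exact: measurableT_comp. Qed.

Lemma measurable_int_delta_approx s : measurable_fun setT
  (fun t : R => \int[mu]_x (f x * y x * delta_approx s (c x + t * y x))).
Proof.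
apply: (measurable_Rintegral1 mu (f := fun (t : R) x => f x * y x * delta_approx s (z x t))).
apply: measurable_funM; first by apply: (mf2 (g := fun x => f x * y x)); exact: measurable_funM.
exact: (measurableT_comp (measurable_delta_approx s) mz').
Qed.

Lemma measurable_int_heaviside : measurable_fun setT
  (fun t : R => \int[mu]_x (f x * heaviside (c x + t * y x))).
Proof.
apply: (measurable_Rintegral1 mu (f := fun (t : R) x => f x * heaviside (z x t))).
apply: measurable_funM; first exact: mf2.
exact: (measurableT_comp measurable_heaviside mz').
Qed.

Lemma measurable_int_heaviside2 : measurable_fun setT
  (fun t : R => \int[mu]_x (f x * heaviside (c x + t * y x) ^+ 2 * y x)).
Proof.
apply: (measurable_Rintegral1 mu (f := fun (t : R) x => f x * heaviside (z x t) ^+ 2 * y x)).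
apply: measurable_funM; last exact: mf2.
apply: measurable_funM; first exact: mf2.
by apply: measurable_funX; exact: (measurableT_comp measurable_heaviside mz').
Qed.

Lemma measurable_int_relu : measurable_fun setT
  (fun t : R => \int[mu]_x (f x * relu (c x + t * y x) * heaviside (c x + t * y x))).
Proof.
apply: (measurable_Rintegral1 mu (f := fun (t : R) x => f x * relu (z x t) * heaviside (z x t))).
apply: measurable_funM; last exact: (measurableT_comp measurable_heaviside mz').
apply: measurable_funM; first exact: mf2.
exact: (measurableT_comp measurable_relu mz').
Qed.

Lemma locally_integrable_int_heaviside (U : set R) : open U ->
  locally_integrable U (fun t => \int[mu]_x (f x * heaviside (c x + t * y x))).
Proof.
move=> oU; apply: locally_integrable_bounded => //; first exact: measurable_int_heaviside.
move=> K cK KU; exists (\int[mu]_x `|f x|) => t _.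
have ih := integrable_mul_heaviside t.
apply: le_trans (le_normr_Rintegral measurableT ih) _.
apply: le_Rintegral => //; [exact: iabs|exact: iabs|].
by move=> x _; rewrite normrM ler_piMr.
Qed.

Lemma locally_integrable_int_heaviside2 (U : set R) : open U ->
  locally_integrable U (fun t => \int[mu]_x (f x * heaviside (c x + t * y x) ^+ 2 * y x)).
Proof.
move=> oU; apply: locally_integrable_bounded => //; first exact: measurable_int_heaviside2.
move=> K cK KU; exists (\int[mu]_x `|f x * y x|) => t _.
have ih := integrable_heaviside2 t.
apply: le_trans (le_normr_Rintegral measurableT ih) _.
apply: le_Rintegral => //; [exact: iabs|exact: iabs|].
by move=> x _; rewrite mulrAC normrM ler_piMr// normrX expr_le1.
Qed.

Lemma locally_integrable_int_relu (U : set R) : open U ->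
  locally_integrable U
    (fun t => \int[mu]_x (f x * relu (c x + t * y x) * heaviside (c x + t * y x))).
Proof.
move=> oU; apply: locally_integrable_bounded => //; first exact: measurable_int_relu.
move=> K cK KU; have [B [_ KB]] := compact_bounded cK.
pose B1 : R := `|B| + 1.
have {}KB t : K t -> `|t| <= B1.
  by apply: KB; rewrite (le_lt_trans (ler_norm _))// ltrDl.
exists (\int[mu]_x (`|f x * c x| + `|B1| * `|f x * y x|)) => t Kt.
have ih := integrable_relu_heaviside t.
apply: le_trans (le_normr_Rintegral measurableT ih) _.
apply: (le_Rintegral measurableT (iabs ih) (icy B1)).
move=> x _; rewrite normrM (le_trans (ler_piMr _ (normH _)))//.
rewrite (le_trans (norm_mul_relu_le x t))// lerD2l ler_wpM2r//.
by rewrite (le_trans (KB _ Kt))// ler_norm.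
Qed.

(** Dominated convergence identifies the distributional limit of the approximate
    delta integrals with their almost everywhere limit. *)
Lemma is_weak_deriv_of_ae_cvg (U : set R) (G : R -> R) : open U ->
  measurable_fun setT G ->
  {ae leb1 R, forall t,
    \int[mu]_x (f x * y x * delta_approx s (c x + t * y x)) @[s --> 0^'+] --> G t} ->
  (forall K : set R, compact K -> K `<=` U -> exists C s0 : R, 0 < s0 /\
    forall t s, K t -> 0 < s < s0 ->
    `|\int[mu]_x (f x * y x * delta_approx s (c x + t * y x))| <= C) ->
  is_weak_deriv U (fun t => \int[mu]_x (f x * heaviside (c x + t * y x))) G.
Proof.
move=> oU mG aeG bnd.
pose A s t := \int[mu]_x (f x * y x * delta_approx s (c x + t * y x)).
have seqs (s0 : R) : 0 < s0 -> exists u : R^nat,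
    (forall n, 0 < u n < s0) /\ u n @[n --> \oo] --> (0 : R).
  move=> s0_gt0; exists (fun n => s0 / 2 * harmonic n); split.
    move=> n; rewrite mulr_gt0 ?harmonic_gt0//=; last by lra.
    have w1 : (n.+1%:R^-1 : R) <= 1 by rewrite invf_le1// ler1n.
    have s20 : 0 < s0 / 2 by rewrite divr_gt0.
    apply: (@le_lt_trans _ _ (s0 / 2 * 1)); first by rewrite ler_pM2l.
    by rewrite mulr1 ltr_pdivrMr// ltr_pMr// ltr1n.
  by rewrite -[X in _ --> X](mulr0 (s0 / 2)); apply: cvgMr; exact: cvg_harmonic.
have aeA (u : R^nat) s0 : (forall n, 0 < u n < s0) -> u n @[n --> \oo] --> (0 : R) ->
    {ae leb1 R, forall t, A (u n) t @[n --> \oo] --> G t}.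
  move=> u0 cu; apply: ae_imply aeG => t /cvg_at_rightP; apply; split => // n.
  by have /andP[] := u0 n.
have mA s : measurable_fun setT (A s) by exact: measurable_int_delta_approx.
split; first exact: locally_integrable_int_heaviside.
- split=> //; first exact: measurable_funS mG.
  move=> K KU cK; have [C [s0 [s0_gt0 KC]]] := bnd K cK KU.
  have [u [u0 cu]] := seqs _ s0_gt0.
  have mK : measurable K by exact: compact_measurable.
  have iC : (leb1 R).-integrable K (EFin \o cst C).
    apply: continuous_compact_integrable => //.
    by apply: continuous_subspaceT => t; exact: cvg_cst.
  have [iG _] := @Rintegral_dct _ _ _ (leb1 R) K (A \o u) G (cst C) mK
    (fun n => measurable_funS measurableT (@subsetT _ K) (mA (u n)))
    (measurable_funS measurableT (@subsetT _ K) mG)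
    (ae_imply (fun t h _ => h) (aeA u s0 u0 cu)) iC
    (fun n t Kt => KC t (u n) Kt (u0 n)).
  by have /integrableP[_] := iG.
- move=> phi tphi; have [dphi [K [cK KU K0]]] := tphi.
  have tphiT : test_function setT phi by split => //; exists K.
  have [C [s0 [s0_gt0 KC]]] := bnd K cK KU.
  have [u [u0 cu]] := seqs _ s0_gt0.
  have [L _ [d0 _ L0]] := test_function_support tphiT.
  have mphi : measurable_fun setT phi.
    by apply: continuous_measurable_fun; exact: continuous_of_derivable.
  have iphi : (leb1 R).-integrable setT (EFin \o (fun t => C * `|phi t|)).
    have : (leb1 R).-integrable setT (EFin \o (fun t => `|phi t|)).
      apply: integrable_norm => //.
      apply: (@integrable_of_compact_support _ _ L); first exact: continuous_of_derivable.
      by move=> t /L0[].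
    by move=> /(integrableZl measurableT C).
  have [//|||||_ cA] := @Rintegral_dct _ _ _ (leb1 R) setT (fun n t => A (u n) t * phi t)
    (fun t => G t * phi t) (fun t => C * `|phi t|) measurableT.
  + by move=> n; apply: measurable_funM => //; exact: mA.
  + exact: measurable_funM.
  + apply: ae_imply (aeA u s0 u0 cu) => t h _; exact: cvgMl.
  + exact: iphi.
  + move=> n t _; have [Kt|nKt] := pselect (K t).
      by rewrite normrM ler_wpM2r// KC.
    by rewrite K0// mulr0 normr0 mulr0.
  have cD := cvg_dist_delta_approx tphiT.
  apply: (@cvg_unique _ _ _ _ _ _ _ cA) => //.
  move/cvg_at_rightP : cD; apply; split => // n.
  by have /andP[] := u0 n.
Qed.

End DistributionalIdentities.

(** * Almost everywhere convergence of averages over thin strips *)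

Lemma measurable_inv (R : realType) : measurable_fun setT (fun x : R => x^-1).
Proof.
have m1 : measurable [set~ (0 : R)] by exact: measurableC.
have -> : setT = [set 0 : R] `|` [set~ 0] by rewrite setUv.
apply/measurable_funU => //; split; first exact: measurable_fun_set1.
apply: open_continuous_measurable_fun.
  rewrite openC; apply: accessible_closed_set1; apply: hausdorff_accessible.
  exact: norm_hausdorff.
by move=> x; rewrite inE/= => /eqP x0; exact: inv_continuous.
Qed.

(** Between consecutive radii [n.+2%:R^-1] and [n.+1%:R^-1] the average [A] varies
    by at most [2 * C / n.+1%:R], because [s * A s] is
    Lipschitz and [A] is bounded. *)
Lemma cvg_at_right_of_seq (R : realType) (A : R -> R) (C l : R) :
  (forall s s', 0 < s' -> s' <= s -> `|s * A s - s' * A s'| <= C * (s - s')) ->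
  (forall s, 0 < s -> `|A s| <= C) ->
  A n.+1%:R^-1 @[n --> \oo] --> l -> A s @[s --> 0^'+] --> l.
Proof.
move=> lipA bA cA.
have C0 : 0 <= C by rewrite (le_trans _ (bA 1 ltr01)).
have step s s' : 0 < s -> s <= s' -> `|A s - A s'| <= 2 * C * ((s' - s) / s).
  move=> s0 ss'.
  have -> : A s - A s' = ((s' - s) * A s' - (s' * A s' - s * A s)) / s.
    by field; exact: lt0r_neq0.
  rewrite normrM normfV (gtr0_norm s0) mulrA ler_pM2r ?invr_gt0//.
  rewrite (le_trans (ler_normB _ _))//.
  have h1 := lipA s' s s0 ss'.
  have h2 : `|(s' - s) * A s'| <= (s' - s) * C.
    rewrite normrM ger0_norm ?subr_ge0// ler_wpM2l ?subr_ge0// bA//.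
    exact: lt_le_trans ss'.
  apply: (le_trans (lerD h2 h1)); by rewrite le_eqVlt; apply/orP; left; apply/eqP; ring.
apply/cvgrPdist_le => e e0.
have e20 : 0 < e / 2 by rewrite divr_gt0.
have C1 : 0 < 2 * C + 1 by lra.
move/cvgrPdist_le : cA => /(_ _ e20) [N _ NA].
have d0 : 0 < Num.min (N.+1%:R^-1) (e / 2 / (2 * C + 1) / 2).
  by rewrite lt_min invr_gt0 ltr0n/= !divr_gt0.
near=> s.
have s0 : 0 < s by near: s; exact: nbhs_right_gt.
have sd : s < Num.min (N.+1%:R^-1) (e / 2 / (2 * C + 1) / 2).
  by near: s; exact: nbhs_right_lt.
move: sd; rewrite lt_min => /andP[sN se].
have s1 : s < 1 by rewrite (lt_le_trans sN)// invf_le1// ler1n.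
have si : 0 <= s^-1 by rewrite invr_ge0 ltW.
have /andP[tr1 tr2] := truncn_itv si.
have Ntr : (N < Num.trunc s^-1)%N.
  have : N.+1%:R < s^-1 by rewrite -[ltLHS]invrK ltf_pV2 ?posrE ?invr_gt0.
  by move=> /lt_trans /(_ tr2); rewrite ltr_nat ltnS.
move: Ntr tr1 tr2; case: (Num.trunc s^-1) => [//|n]; rewrite ltnS => Nn tr1 tr2.
have n0 : 0 < n.+1%:R :> R by rewrite ltr0n.
have sn : s <= n.+1%:R^-1 by rewrite -[leLHS]invrK lef_pV2 ?posrE ?invr_gt0.
have ratio : (n.+1%:R^-1 - s) / s <= 2 * s.
  rewrite mulrBl divff ?lt0r_neq0//.
  have h : s^-1 <= n.+1%:R + 1 by rewrite natr1 ltW.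
  have h2 : n.+1%:R^-1 <= 2 * s.
    have h1 : 1 <= (n.+1%:R + 1) * s by rewrite -ler_pdivrMr// div1r.
    rewrite -[leLHS]mul1r ler_pdivrMr//.
    have x1 : 1 <= n.+1%:R :> R by rewrite ler1n.
    by move: (n.+1%:R : R) h1 x1 => x h1 x1; nra.
  have -> : n.+1%:R^-1 / s = s^-1 * n.+1%:R^-1 by rewrite mulrC.
  have : s^-1 * n.+1%:R^-1 <= (n.+1%:R + 1) * n.+1%:R^-1.
    by rewrite ler_wpM2r// invr_ge0 ltW.
  rewrite mulrDl divff ?lt0r_neq0// mul1r.
  by move=> h3; apply: (le_trans _ h2); rewrite lerBlDl.
have h1 := NA n Nn.
have h2 := step s _ s0 sn.
rewrite distrC.
have -> : A s - l = (A s - A n.+1%:R^-1) + (A n.+1%:R^-1 - l) by ring.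
rewrite (le_trans (ler_normD _ _))// [leRHS]splitr lerD//; last by rewrite distrC.
rewrite (le_trans h2)//.
apply: (@le_trans _ _ (2 * C * (2 * s))); first by rewrite ler_wpM2l// mulr_ge0.
have : (2 * C + 1) * (2 * s) <= e / 2.
  rewrite mulrC -ler_pdivlMr// mulrC -ler_pdivlMr//; exact: ltW.
by move=> h3; apply: le_trans h3; rewrite ler_wpM2r ?mulr_ge0 ?ltW//; lra.
Unshelve. all: by end_near. Qed.

(** The strip [`|alpha u t + q t * v| < s] meets the line of abscissa [u] in an
    interval centred at [- alpha u t / q t], provided [q t != 0]. *)
Section StripAverages.
Context {R : realType}.
Variables (k : R -> R -> R) (kappa : R -> R) (alpha : R -> R -> R) (q : R -> R).
Hypothesis mk : measurable_fun setT (fun z : R * R => k z.1 z.2).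
Hypothesis ik : (leb1 R).-integrable setT (EFin \o kappa).
Hypothesis kk : forall u v, `|k u v| <= kappa u.
Hypothesis malpha : measurable_fun setT (fun z : R * R => alpha z.1 z.2).
Hypothesis mq : measurable_fun setT q.

Let K : R := \int[leb1 R]_u kappa u.

Let mku u : measurable_fun setT (k u).
Proof. exact: (measurableT_comp mk (measurable_pair1 u)). Qed.

Let a s u t := \int[leb1 R]_v (k u v * delta_approx s (alpha u t + q t * v)).

Let ma s : measurable_fun setT (fun z : R * R => a s z.1 z.2).
Proof.
apply: (measurable_Rintegral1 (leb1 R) (f := fun (z : R * R) (v : R) =>
  k z.1 v * delta_approx s (alpha z.1 z.2 + q z.2 * v))).
apply: measurable_funM.
  apply: (measurableT_comp mk (g := fun z : R * R * R => (z.1.1, z.2))).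
  apply: measurable_fun_pair => //.
  exact: (measurableT_comp measurable_fst measurable_fst).
apply: (measurableT_comp (measurable_delta_approx s)).
apply: measurable_funD; first exact: (measurableT_comp malpha measurable_fst).
apply: measurable_funM => //.
exact: (measurableT_comp mq (measurableT_comp measurable_snd measurable_fst)).
Qed.

Let mat s t : measurable_fun setT (a s ^~ t).
Proof. exact: (measurableT_comp (ma s) (measurable_pair2 t)). Qed.

Let a_le (s u t : R) : 0 < s -> q t != 0 -> `|a s u t| <= kappa u / `|q t|.
Proof. by move=> s0 q0; apply: Rintegral_delta_approx_le. Qed.

Let ikq (w : R) : (leb1 R).-integrable setT (EFin \o (fun u => kappa u / w)).
Proof. by have := integrableZr measurableT w^-1 ik. Qed.

Lemma strip_average_le (s t : R) : 0 < s -> q t != 0 ->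
  `|\int[leb1 R]_u \int[leb1 R]_v (k u v * delta_approx s (alpha u t + q t * v))|
  <= (\int[leb1 R]_u kappa u) / `|q t|.
Proof.
move=> s0 q0.
have ia : (leb1 R).-integrable setT (EFin \o (a s ^~ t)).
  by apply: (integrable_bound _ (ikq `|q t|)); [exact: mat|move=> u; exact: a_le].
apply: le_trans (le_normr_Rintegral measurableT ia) _.
rewrite -RintegralZr//; apply: (le_Rintegral measurableT (integrable_norm ia) (ikq _)).
by move=> u _; exact: a_le.
Qed.

(* As s * delta_approx s is half the indicator of a window, the difference of two
   such products is nonnegative and its integral is explicit. *)
Let strip_lip (s s' t : R) : 0 < s' -> s' <= s -> q t != 0 ->
  `|s * (\int[leb1 R]_u a s u t) - s' * (\int[leb1 R]_u a s' u t)|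
  <= (K / `|q t|) * (s - s').
Proof.
move=> s'0 ss' q0; have s0 : 0 < s by exact: lt_le_trans ss'.
have ia (r : R) : 0 < r -> (leb1 R).-integrable setT (EFin \o (a r ^~ t)).
  by move=> r0; apply: (integrable_bound _ (ikq `|q t|)); [exact: mat|move=> u; exact: a_le].
have iZ (r : R) (r0 : 0 < r) : (leb1 R).-integrable setT (EFin \o (fun u => r * a r u t)).
  by have := integrableZl measurableT r (ia r r0).
rewrite -(RintegralZl _ measurableT (ia s s0)) -(RintegralZl _ measurableT (ia s' s'0)).
rewrite -(RintegralB measurableT (iZ s s0) (iZ s' s'0)).
have iB : (leb1 R).-integrable setT (EFin \o (fun u => s * a s u t - s' * a s' u t)).
  by have := integrableB measurableT (iZ s s0) (iZ s' s'0).
apply: le_trans (le_normr_Rintegral measurableT iB) _.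
have -> : K / `|q t| * (s - s') = \int[leb1 R]_u (kappa u / `|q t| * (s - s')).
  by rewrite (RintegralZr _ measurableT (ikq `|q t|)) (RintegralZr _ measurableT ik).
have ikqs : (leb1 R).-integrable setT
    (EFin \o (fun u => kappa u / `|q t| * (s - s'))).
  by have := integrableZr measurableT (s - s') (ikq `|q t|).
apply: (le_Rintegral measurableT (integrable_norm iB) ikqs).
move=> u _.
have id (r : R) (r0 : 0 < r) := integrable_delta_approx (alpha u t) r0 q0.
have ikd (r : R) (r0 : 0 < r) := integrable_bounded_delta_approx (alpha u t) r0 q0 (mku u) (kk u).
pose D r v := delta_approx r (alpha u t + q t * v).
have iZd (r : R) (r0 : 0 < r) : (leb1 R).-integrable setT (EFin \o (fun v => r * D r v)).
  by have := integrableZl measurableT r (id r r0).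
have iZkd (r : R) (r0 : 0 < r) : (leb1 R).-integrable setT (EFin \o (fun v => r * (k u v * D r v))).
  by have := integrableZl measurableT r (ikd r r0).
have D0 v : 0 <= s * D s v - s' * D s' v.
  rewrite /D !delta_approx_norm.
  have h (r : R) : 0 < r -> r * (2 * r)^-1 = 2^-1 by move=> r0; field; exact: lt0r_neq0.
  case: ifP => h1; case: ifP => h2; rewrite ?mulr0 ?h// ?subrr ?subr0 ?invr_ge0//.
  by have := lt_le_trans h2 ss'; rewrite h1.
have aE (r : R) (r0 : 0 < r) :
    r * a r u t = \int[leb1 R]_v (r * (k u v * D r v)).
  by rewrite (RintegralZl _ measurableT (ikd r r0)).
rewrite /= (aE s s0) (aE s' s'0).
rewrite -(RintegralB measurableT (iZkd s s0) (iZkd s' s'0)).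
have iBd : (leb1 R).-integrable setT
    (EFin \o (fun v => s * (k u v * D s v) - s' * (k u v * D s' v))).
  by have := integrableB measurableT (iZkd s s0) (iZkd s' s'0).
apply: le_trans (le_normr_Rintegral measurableT iBd) _.
have iDD : (leb1 R).-integrable setT (EFin \o (fun v => s * D s v - s' * D s' v)).
  by have := integrableB measurableT (iZd s s0) (iZd s' s'0).
have -> : kappa u / `|q t| * (s - s') =
    \int[leb1 R]_v (kappa u * (s * D s v - s' * D s' v)).
  rewrite RintegralZl// (RintegralB measurableT (iZd s s0) (iZd s' s'0)).
  have DE (r : R) (r0 : 0 < r) : \int[leb1 R]_v (r * D r v) = r * `|q t|^-1.
    by rewrite (RintegralZl _ measurableT (id r r0)) Rintegral_delta_approx.
  by rewrite (DE s s0) (DE s' s'0); ring.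
have ikD : (leb1 R).-integrable setT
    (EFin \o (fun v => kappa u * (s * D s v - s' * D s' v))).
  by have := integrableZl measurableT (kappa u) iDD.
apply: (le_Rintegral measurableT (integrable_norm iBd) ikD).
move=> v _ /=.
have -> : s * (k u v * D s v) - s' * (k u v * D s' v) =
  k u v * (s * D s v - s' * D s' v) by ring.
by rewrite normrM (ger0_norm (D0 v)) ler_wpM2r.
Qed.

(** For almost every [u] the inner averages converge for almost every [t], by
    Lebesgue differentiation; Tonelli exchanges the two quantifiers, and
    dominated convergence integrates the limit over [u]. *)
Lemma ae_cvg_strip_average :
  {ae leb1 R, forall t, q t != 0} ->
  {ae leb1 R, forall u, {ae leb1 R, forall t, lebesgue_pt (k u) (- alpha u t / q t)}} ->
  {ae leb1 R, forall t, exists l : R,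
    \int[leb1 R]_u \int[leb1 R]_v (k u v * delta_approx s (alpha u t + q t * v))
      @[s --> 0^'+] --> l}.
Proof.
move=> aeq aelp.
pose g u t := k u (- alpha u t / q t) / `|q t|.
have mg : measurable_fun setT (fun z : R * R => g z.1 z.2).
  apply: measurable_funM.
    apply: (measurableT_comp mk (g := fun z : R * R => (z.1, - alpha z.1 z.2 / q z.2))).
    apply: measurable_fun_pair => //.
    apply: measurable_funM; first exact: measurableT_comp.
    apply: (measurableT_comp (@measurable_inv R)); exact: (measurableT_comp mq measurable_snd).
  apply: (measurableT_comp (@measurable_inv R)); apply: measurableT_comp => //.
  exact: (measurableT_comp mq measurable_snd).
pose w (n : nat) (z : R * R) : \bar R := `|a n.+1%:R^-1 z.1 z.2 - g z.1 z.2|%:E.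
have mw n : measurable_fun setT (w n).
  apply/measurable_EFinP; apply: measurableT_comp => //.
  by apply: measurable_funB; [exact: ma|exact: mg].
(* convergence along the radii n.+1%:R^-1, expressed so as to be measurable *)
pose P u t := limn_esup (w ^~ (u, t)) = 0%E.
have mP : measurable [set z : R * R | P z.1 z.2].
  have -> : [set z : R * R | P z.1 z.2] =
      ~` (setT `&` [set z | limn_esup (w ^~ z) != 0%E]).
    apply/seteqP; split => -[u t]; rewrite /P/=.
      by move=> -> []; rewrite eqxx.
    by move=> /not_andP[//|/negP]; rewrite negbK => /eqP.
  apply: measurableC; apply: emeasurable_neq => //.
  exact: measurable_fun_limn_esup.
have aeP : {ae leb1 R, forall u, {ae leb1 R, forall t, P u t}}.
  apply: ae_imply aelp => u lp.
  apply: ae_imply (ae_and aeq lp) => t [q0 {}lp].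
  have ca := cvg_delta_approx q0 (mku u) (kk u) lp.
  have cs : a n.+1%:R^-1 u t @[n --> \oo] --> g u t.
    move/cvg_at_rightP : ca; apply; split; first by move=> n; rewrite invr_gt0.
    exact: cvg_harmonic.
  have cw : w n (u, t) @[n --> \oo] --> 0%E.
    rewrite /w/=; apply/fine_cvgP; split; first exact: nearW.
    rewrite /comp/= -(@normr0 _ R); apply: cvg_norm.
    by rewrite -[X in _ --> X](subrr (g u t)); apply: cvgB => //; exact: cvg_cst.
  rewrite /P is_cvg_limn_esupE; last by apply/cvg_ex; exists 0%E.
  exact/cvg_lim.
have aePt := @ae_swap _ _ _ _ R (leb1 R) (leb1 R) P mP aeP.
apply: ae_imply (ae_and aeq aePt) => t [q0 {}aePt].
exists (\int[leb1 R]_u g u t).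
apply: (@cvg_at_right_of_seq _ _ (K / `|q t|)).
- by move=> s s' s'0 ss'; exact: strip_lip.
- by move=> s s0; exact: strip_average_le.
apply: (proj2 (@Rintegral_dct _ _ _ (leb1 R) setT (fun n u => a n.+1%:R^-1 u t)
  (g ^~ t) (fun u => kappa u / `|q t|) measurableT _ _ _ (ikq _) _)).
- by move=> n; exact: mat.
- exact: (measurableT_comp mg (measurable_pair2 t)).
- apply: ae_imply aePt => u Put _.
  have cw : w n (u, t) @[n --> \oo] --> 0%E.
    by apply: limn_esup_le_cvg; [rewrite Put|move=> n; rewrite lee_fin].
  have {}cw : `|a n.+1%:R^-1 u t - g u t| @[n --> \oo] --> (0 : R) by exact: (fine_cvg cw).
  by apply/subr_cvg0; apply/norm_cvg0P.
- by move=> n u _; apply: a_le => //; rewrite invr_gt0.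
Qed.

End StripAverages.

(** * Null sets under affine maps and inversion *)

Section NullPreimages.
Context {R : realType}.
Implicit Types (P : R -> Prop) (a b : R).

Lemma lebesgue_measure_affine_preimage a b (A : set R) : b != 0 -> measurable A ->
  leb1 R ((fun t => a + b * t) @^-1` A) = (`|b|^-1%:E * leb1 R A)%E.
Proof.
move=> b0 mA.
pose f (t : R) : measurableTypeR R := a + b * t.
have mf : measurable_fun setT f.
  by apply: measurable_funD => //; exact: measurable_funM.
have nb0 : 0 < `|b| by rewrite normr_gt0.
pose m := mscale (NngNum (normr_ge0 b)) (pushforward (leb1 R) f).
have E : leb1 R A = m mf A.
  apply: lebesgue_measure_unique => // _ [[x y] _ <-].
  have preE : f @^-1` `]x, y]%classic =
      if 0 < b then `](x - a) / b, (y - a) / b]%classic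
      else `[(y - a) / b, (x - a) / b[%classic.
    apply/seteqP; split => t; rewrite /f/=; case: ifPn => bs; rewrite /= !in_itv /=.
    - by rewrite ltr_pdivrMr// ler_pdivlMr// mulrC ltrBlDl lerBrDl.
    - have bn : b < 0 by rewrite lt_neqAle b0 leNgt.
      by rewrite ler_ndivrMr// ltr_ndivlMr// mulrC ltrBlDl lerBrDl andbC.
    - by rewrite ltr_pdivrMr// ler_pdivlMr// mulrC ltrBlDl lerBrDl.
    - have bn : b < 0 by rewrite lt_neqAle b0 leNgt.
      by rewrite ler_ndivrMr// ltr_ndivlMr// mulrC ltrBlDl lerBrDl andbC.
  transitivity (`|b|%:E * leb1 R (f @^-1` `]x, y]%classic))%E; last by [].
  rewrite preE lebesgue_measure_itv/= lte_fin.
  have [bs|bs] := boolP (0 < b); rewrite lebesgue_measure_itv/= lte_fin.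
    rewrite ltr_pM2r ?invr_gt0// ltrD2r; case: ifP => _; last by rewrite mule0.
    by rewrite -!EFinD -EFinM gtr0_norm//; congr EFin; field.
  have bn : b < 0 by rewrite lt_neqAle b0 leNgt.
  rewrite ltr_nM2r ?invr_lt0// ltrD2r; case: ifP => _; last by rewrite mule0.
  by rewrite -!EFinD -EFinM ltr0_norm//; congr EFin; field.
rewrite E /m /mscale/= muleA -EFinM mulVf ?mul1e//.
exact: lt0r_neq0.
Qed.

Lemma ae_neq (p : R) : {ae leb1 R, forall t, t != p}.
Proof.
exists [set p]; split => //; first exact: lebesgue_measure_set1.
by move=> t /= /negP; rewrite negbK => /eqP.
Qed.

Lemma ae_affine P a b : b != 0 -> {ae leb1 R, forall v, P v} ->
  {ae leb1 R, forall t, P (a + b * t)}.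
Proof.
move=> b0 [N [mN N0 PN]]; exists ((fun t => a + b * t) @^-1` N); split.
- rewrite -[X in measurable X]setTI.
  by apply: (_ : measurable_fun setT (fun t => a + b * t)) => //;
    apply: measurable_funD => //; exact: measurable_funM.
- by rewrite lebesgue_measure_affine_preimage// N0 mule0.
- by move=> t /= nP; exact: PN.
Qed.

(** Dilations reduce the inversion to affine maps. For each [t != 0] the property
    holds at [- b / t * v] for almost every [v]; by Tonelli some [v != 0] is such
    that it holds there for almost every [t], and the dilation by [v] in [t]
    removes this factor. *)
Lemma ae_inversion P b : b != 0 -> {ae leb1 R, forall v, P v} ->
  {ae leb1 R, forall t, P (- b / t)}.
Proof.
move=> b0 [N [mN N0 PN]].
have aeN : {ae leb1 R, forall v, ~ N v}.
  exists N; split => // v /= nnN; exact: contrapT.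
have aet := ae_neq 0.
pose Q (t v : R) := ~ N (- b / t * v).
have mQ : measurable [set z : R * R | Q z.1 z.2].
  rewrite (_ : mkset _ = ~` ((fun z : R * R => - b / z.1 * z.2) @^-1` N)) //.
  apply: measurableC; rewrite -[X in measurable X]setTI.
  suff : measurable_fun setT (fun z : R * R => - b / z.1 * z.2) by exact.
  apply: measurable_funM => //; apply: measurable_funM => //.
  exact: (measurableT_comp (@measurable_inv R)).
have aeQ : {ae leb1 R, forall t, {ae leb1 R, forall v, Q t v}}.
  apply: ae_imply aet => t t0.
  have := ae_affine 0 (b := - b / t) _ aeN; rewrite mulf_neq0 ?oppr_eq0 ?invr_eq0//.
  by move=> /(_ isT); apply: ae_imply => v; rewrite add0r.
have aeQ' := @ae_swap _ _ _ _ R (leb1 R) (leb1 R) Q mQ aeQ.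
have [v [v0 Qv]] : exists v, v != 0 /\ {ae leb1 R, forall t, Q t v}.
  have := ae_and aet aeQ'; apply: contraPP => /forallNP nex [M [mM M0 MM]].
  have : leb1 R `[0, 1]%classic = 0%E.
    by apply: measure_negligible => //; exists M; split => // x _; apply: MM; exact: nex.
  rewrite lebesgue_measure_itv/= lte_fin ltr01 -EFinB subr0 => /eqP.
  by rewrite eqe oner_eq0.
have := ae_affine 0 v0 Qv; apply: ae_imply => t; rewrite add0r /Q.
have -> : - b / (v * t) * v = - b / t.
  have [->|t0] := eqVneq t 0; first by rewrite mulr0 invr0 !mulr0 mul0r.
  by field; rewrite t0 v0.
by move=> nN; apply: contrapT => nP; apply: nN; exact: PN.
Qed.

End NullPreimages.

(** * Two families of strips *)

(** What dominated convergence needs in order to pass to the limit in the integral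
    of [A s] against a test function supported in [U]. *)
Definition ae_cvg_locally_bounded (R : realType) (U : set R) (A : R -> R -> R) :=
  {ae leb1 R, forall t, exists l : R, A s t @[s --> 0^'+] --> l} /\
  (forall K : set R, compact K -> K `<=` U -> exists C s0 : R, 0 < s0 /\
    forall t s, K t -> 0 < s < s0 -> `|A s t| <= C).

Section TwoFamiliesOfStrips.
Context {R : realType}.
Variables (f : R -> R -> R) (M D : R).
Hypothesis mf : measurable_fun setT (fun z : R * R => f z.1 z.2).
Hypothesis D0 : 0 <= D.
Hypothesis fM : forall u v, `|f u v| <= M.
Hypothesis f0 : forall u v, D < `|u| \/ D < `|v| -> f u v = 0.

Let M0 : 0 <= M. Proof. exact: le_trans (fM 0 0). Qed.

Let kappa (B : R) (u : R) : R := B * \1_(`[- D, D]%classic : set R) u.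

Let integrable_kappa B : (leb1 R).-integrable setT (EFin \o kappa B).
Proof.
by have := integrableZl measurableT B (integrable_indic_itv (- D) D true false).
Qed.

Let le_kappa (g : R -> R -> R) (B : R) : 0 <= B ->
  (forall u v, `|u| <= D -> `|v| <= D -> `|g u v| <= B) ->
  forall u v, `|f u v * g u v| <= kappa (M * B) u.
Proof.
move=> B0 gB u v; rewrite /kappa indicE mem_setE in_itv/= -ler_norml.
have [uD|uD] := leP `|u| D; last by rewrite f0 ?mul0r ?normr0 ?mulr0//; left.
have [vD|vD] := leP `|v| D; last by rewrite f0 ?mul0r ?normr0 ?mulr1 ?mulr_ge0//; right.
by rewrite mulr1 normrM ler_pM// gB.
Qed.

Let lebesgue_pt_ae (g : R -> R) (C : R) : measurable_fun setT g ->
  (forall v, `|g v| <= C) -> {ae leb1 R, forall v, lebesgue_pt g v}.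
Proof.
move=> mg gC; apply: lebesgue_differentiation.
by apply: locally_integrable_bounded => //; [exact: openT|move=> K _ _; exists C].
Qed.

(** For fixed [u] the intersection with the line moves affinely with [t], so that
    Lebesgue points are met for almost every [t] as soon as [beta u != 0]. *)
Lemma transverse_strips (alpha beta : R -> R) (q B : R) :
  measurable_fun setT alpha -> measurable_fun setT beta ->
  q != 0 -> {ae leb1 R, forall u, beta u != 0} ->
  0 <= B -> (forall u, `|u| <= D -> `|beta u| <= B) ->
  ae_cvg_locally_bounded setT (fun s t => \int[leb1 R]_u \int[leb1 R]_v
    (f u v * beta u * delta_approx s (alpha u + t * beta u + q * v))).
Proof.
move=> malpha mbeta q0 aebeta B0 betaB.
pose k u v := f u v * beta u.
pose al u t := alpha u + t * beta u.
have mk : measurable_fun setT (fun z : R * R => k z.1 z.2).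
  by apply: measurable_funM => //; exact: measurableT_comp.
have mal : measurable_fun setT (fun z : R * R => al z.1 z.2).
  apply: measurable_funD; first exact: measurableT_comp.
  by apply: measurable_funM => //; exact: measurableT_comp.
have kk := le_kappa (g := fun u _ => beta u) B0 (fun u v uD _ => betaB u uD).
split.
- apply: (@ae_cvg_strip_average R k _ al (fun=> q) mk (integrable_kappa _) kk mal) => //.
    exact: aeW.
  apply: ae_imply aebeta => u bu.
  have mku : measurable_fun setT (k u) by exact: (measurableT_comp mk (measurable_pair1 u)).
  have b0 : - (beta u / q) != 0 by rewrite oppr_eq0 mulf_neq0 ?invr_eq0.
  have := ae_affine (- (alpha u / q)) b0 (lebesgue_pt_ae mku (kk u)).
  apply: ae_imply => t; congr lebesgue_pt; rewrite /al; field; exact: q0.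
- move=> K _ _; exists ((\int[leb1 R]_u kappa (M * B) u) / `|q|), 1; split => //.
  move=> t s _ /andP[s0 _].
  exact: (strip_average_le mk (integrable_kappa _) kk mal (q := fun=> q) _ s0 q0).
Qed.

(** The lines are orthogonal to the direction [v], at position [- b / t]. If
    [b != 0], the inversion preserves null sets, and for small [t] the line has
    left the support of [f]. If [b = 0], the line stays at [v = 0], where
    [f u v * v] is continuous. *)
Lemma parallel_strips (b : R) :
  ae_cvg_locally_bounded [set t | t != 0 \/ b != 0]
    (fun s t => \int[leb1 R]_u \int[leb1 R]_v (f u v * v * delta_approx s (b + t * v))).
Proof.
pose k u v := f u v * v.
have mk : measurable_fun setT (fun z : R * R => k z.1 z.2) by exact: measurable_funM.
have kk := le_kappa (g := fun _ v => v) D0 (fun u v _ vD => vD).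
have mal : measurable_fun setT (fun z : R * R => (fun _ _ => b) z.1 z.2 : R) by [].
have mku u : measurable_fun setT (k u) by exact: (measurableT_comp mk (measurable_pair1 u)).
split.
- apply: (@ae_cvg_strip_average R k _ (fun _ _ => b) idfun mk (integrable_kappa _) kk mal (@measurable_id _ R setT) (ae_neq 0)).
  apply: aeW => u.
  have [b0|b0] := eqVneq b 0; last exact: (ae_inversion b0 (lebesgue_pt_ae (mku u) (kk u))).
  apply: aeW => t; rewrite b0 oppr0 mul0r.
  apply: (@continuous_lebesgue_pt _ _ _ setT) => //.
    by split => //; exact: openT.
  suff : k u v @[v --> (0 : R)] --> (0 : R) by rewrite -[X in _ --> X -> _](mulr0 (f u 0)).
  apply/cvgr0Pnorm_le => e e0.
  have M1 : 0 < M + 1 by rewrite ltr_wpDl.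
  near=> v; rewrite normrM (@le_trans _ _ ((M + 1) * `|v|))//.
    by rewrite ler_wpM2r// (le_trans (fM u v))// lerDl.
  rewrite -ler_pdivlMl//; near: v.
  have d0 : 0 < (M + 1)^-1 * e by rewrite mulr_gt0 ?invr_gt0.
  have := nbhsx_ballx (0 : R) _ d0; apply: filterS => v.
  by rewrite -ball_normE/= sub0r normrN => /ltW.
- move=> K cK KU; pose I := \int[leb1 R]_u kappa (M * D) u.
  have I0 : 0 <= I by apply: Rintegral_ge0 => u _; rewrite mulr_ge0// mulr_ge0.
  have bound (s t : R) : 0 < s -> t != 0 -> `|\int[leb1 R]_u \int[leb1 R]_v
      (f u v * v * delta_approx s (b + t * v))| <= I / `|t|.
    by move=> s0 t0; exact: (strip_average_le mk (integrable_kappa _) kk mal (@measurable_id _ R setT) s0 t0).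
  have [b0|b0] := eqVneq b 0.
    have nK0 : ~ K 0 by move=> /KU/= []; rewrite ?b0 eqxx.
    have : nbhs (0 : R) (~` K).
      apply: open_nbhs_nbhs; split => //; rewrite openC.
      exact: (compact_closed (@norm_hausdorff R R^o) cK).
    move=> /nbhs_ballP[e /= e0 eK].
    exists (I / e), 1; split => // t s Kt /andP[s0 _].
    have et : e <= `|t|.
      rewrite leNgt; apply/negP => te; apply: (eK t) => //.
      by rewrite -ball_normE/= sub0r normrN.
    have t0 : t != 0 by rewrite -normr_gt0 (lt_le_trans e0).
    apply: le_trans (bound s t s0 t0) _.
    by rewrite ler_wpM2l// lef_pV2// posrE normr_gt0.
  have nb0 : 0 < `|b| by rewrite normr_gt0.
  have D1 : 0 < D + 1 by rewrite ltr_wpDl.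
  pose e := `|b| / 2 / (D + 1).
  have e0 : 0 < e by rewrite !divr_gt0.
  exists (I / e), (`|b| / 2); split; first by rewrite divr_gt0.
  move=> t s Kt /andP[s0 sb].
  have [et|te] := leP e `|t|.
    have t0 : t != 0 by rewrite -normr_gt0 (lt_le_trans e0).
    apply: le_trans (bound s t s0 t0) _.
    by rewrite ler_wpM2l// lef_pV2// posrE normr_gt0.
  suff -> : \int[leb1 R]_u \int[leb1 R]_v (f u v * v * delta_approx s (b + t * v)) = 0.
    by rewrite normr0 divr_ge0// ltW.
  have z0 (u v : R) : f u v * v * delta_approx s (b + t * v) = 0.
    have [vD|vD] := leP `|v| D; last by rewrite f0 ?mul0r//; right.
    rewrite delta_approx_norm ltNge (_ : s <= `|b + t * v|) ?mulr0//.
    rewrite (le_trans (ltW sb))//.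
    have h1 := ler_normB (b + t * v) (t * v); rewrite addrK normrM in h1.
    have h2 : `|t| * `|v| <= e * (D + 1).
      by rewrite ler_pM// ?ltW// (le_lt_trans vD)// ltrDl.
    rewrite /e divfK ?lt0r_neq0// in h2; lra.
  under eq_Rintegral do under eq_Rintegral do rewrite z0.
  under eq_Rintegral do rewrite Rintegral_cst// mul0r.
  by rewrite Rintegral_cst// mul0r.
Unshelve. all: by end_near. Qed.

End TwoFamiliesOfStrips.

(** * Measurability in the plane and the reduction to a Borel integrand *)

Section Plane.
Context {R : realType}.
Implicit Types (U A : set (R * R)) (h : R * R -> R).

(** An open set is the union of the squares of rational centre and radius
    [n.+1%:R^-1] that it contains. *)
Lemma open_measurable_plane U : open U -> measurable U.
Proof.
move=> oU.
pose box (i : rat * rat * nat) : set (R * R) :=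
  ball (ratr i.1.1 : R) i.2.+1%:R^-1 `*` ball (ratr i.1.2 : R) i.2.+1%:R^-1.
have -> : U = \bigcup_i (if `[< box i `<=` U >] then box i else set0).
  apply/seteqP; split => [x Ux|x [i _]]; last first.
    by case: asboolP => // + xi; apply.
  have /nbhs_ballP[e /= e0 eU] : nbhs x U by exact: open_nbhs_nbhs.
  have [n ne] : exists n : nat, n.+1%:R^-1 < e / 2.
    have e20 : 0 < e / 2 by rewrite divr_gt0.
    by have [n _ /(_ n (leqnn n))] := near_infty_natSinv_lt (PosNum e20); exists n.
  have n0 : 0 < n.+1%:R^-1 :> R by rewrite invr_gt0.
  have rat_near (z : R) : exists q : rat, `|ratr q - z| < n.+1%:R^-1.
    have zz : z - n.+1%:R^-1 < z + n.+1%:R^-1 by rewrite ltrBlDr -addrA ltrDl addr_gt0.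
    have [q] := rat_in_itvoo zz.
    by rewrite in_itv/= => qz; exists q; rewrite ltr_distl.
  have [q1 qx1] := rat_near x.1; have [q2 qx2] := rat_near x.2.
  exists (q1, q2, n) => //; case: asboolP => [_|]; first by split; rewrite -ball_normE.
  case=> z [/=]; rewrite -ball_normE /= => z1 z2; apply: eU; split; rewrite -ball_normE/=.
  - rewrite (le_lt_trans (ler_distD (ratr q1) _ _))// [ltRHS]splitr distrC.
    by rewrite ltrD// (lt_trans _ ne).
  - rewrite (le_lt_trans (ler_distD (ratr q2) _ _))// [ltRHS]splitr distrC.
    by rewrite ltrD// (lt_trans _ ne).
apply: countable_bigcupT_measurable; first exact: countableP.
by move=> i; case: ifP => _ //; apply: measurableX; exact: measurable_ball.
Qed.

Lemma within_continuous_measurable_plane A h : measurable A ->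
  {within A, continuous h} -> measurable_fun A h.
Proof.
move=> mA /continuousP cf; apply: (measurability _ (RGenOpens.measurableE R)).
move=> _ [_ [a [b ->] <-]].
have /open_subspaceP[V oV VA] := cf _ (@interval_open _ (BRight a) (BLeft b) isT isT).
rewrite setIC -VA; apply: measurableI => //; exact: open_measurable_plane.
Qed.

Lemma ord3P (i : 'I_3) : [\/ i = 0, i = inord 1 | i = inord 2].
Proof.
case: i => [[|[|[|//]]] hi].
- by apply: Or31; exact: val_inj.
- by apply: Or32; apply: val_inj; rewrite /= inordK.
- by apply: Or33; apply: val_inj; rewrite /= inordK.
Qed.

Lemma hcoordE (x : R * R) :
  ((hcoord x 0 0 = 1) * (hcoord x (inord 1) 0 = x.1) * (hcoord x (inord 2) 0 = x.2))%type.
Proof. by rewrite !mxE /= !inordK. Qed.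

Lemma dotE (r : 'cV[R]_3) (x : R * R) :
  dot r (hcoord x) = r 0 0 + r (inord 1) 0 * x.1 + r (inord 2) 0 * x.2.
Proof.
rewrite /dot mxE !big_ord_recl big_ord0 addr0.
have -> : lift ord0 ord0 = inord 1 :> 'I_3 by apply: val_inj; rewrite /= inordK.
have -> : lift ord0 (lift ord0 ord0) = inord 2 :> 'I_3.
  by apply: val_inj; rewrite /= inordK.
by rewrite !mxE /= !inordK// mulr1 addrA.
Qed.

Lemma inord3_neq : (((inord 1 : 'I_3) == 0) = false) * (((inord 2 : 'I_3) == 0) = false) *
  (((0 : 'I_3) == inord 1) = false) * (((0 : 'I_3) == inord 2) = false) *
  (((inord 1 : 'I_3) == inord 2) = false) * (((inord 2 : 'I_3) == inord 1) = false).
Proof. by rewrite -!val_eqE /= !inordK. Qed.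

Lemma dot_subst_comp (r : 'cV[R]_3) (i : 'I_3) (t : R) (x : R * R) :
  dot (subst_comp r i t) (hcoord x) =
  dot (subst_comp r i 0) (hcoord x) + t * hcoord x i 0.
Proof.
rewrite !dotE ![subst_comp _ _ _ _ _]mxE.
by case: (ord3P i) => ->; rewrite !hcoordE !inord3_neq !eqxx; ring.
Qed.

Lemma measurable_dot (r : 'cV[R]_3) : measurable_fun setT (fun x => dot r (hcoord x)).
Proof.
under eq_fun do rewrite dotE.
apply: measurable_funD; last exact: measurable_funM.
by apply: measurable_funD => //; exact: measurable_funM.
Qed.

Lemma measurable_hcoord (i : 'I_3) : measurable_fun setT (fun x : R * R => hcoord x i 0).
Proof.
case: (ord3P i) => ->; under eq_fun do rewrite hcoordE.
- exact: measurable_cst.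
- exact: measurable_fst.
- exact: measurable_snd.
Qed.

Lemma slope_neq0 (r : 'cV[R]_3) : slope_norm r = 1 ->
  r (inord 1) 0 != 0 \/ r (inord 2) 0 != 0.
Proof.
have [r10|] := eqVneq (r (inord 1) 0) 0; last by left.
have [r20|] := eqVneq (r (inord 2) 0) 0; last by right.
by rewrite /slope_norm r10 r20 expr0n addr0 sqrtr0 => /esym/eqP; rewrite oner_eq0.
Qed.

(** One of the two slopes is nonzero, so the line meets almost every vertical line
    in at most one point. *)
Lemma line_null (r : 'cV[R]_3) : slope_norm r = 1 ->
  measurable [set x : R * R | dot r (hcoord x) = 0] /\
  leb2 R [set x : R * R | dot r (hcoord x) = 0] = 0%E.
Proof.
move=> /slope_neq0 rn0; set N := mkset _.
have mN : measurable N.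
  rewrite (_ : N = (fun x => dot r (hcoord x)) @^-1` [set 0])//.
  by rewrite -[X in measurable X]setTI; exact: measurable_dot.
split=> //.
have ae0 : {ae leb1 R, forall u, {ae leb1 R, forall v, ~ N (u, v)}}.
  have pt (p : R) : {ae leb1 R, forall v, v <> p}.
    by apply: ae_imply (ae_neq p) => v /eqP.
  have solve (a b q v : R) : q != 0 -> a + q * v + b = 0 -> v = - (a + b) / q.
    move=> q0 e; have -> : a + b = - (q * v) by lra.
    by rewrite opprK mulrC mulKf.
  have [r20|r20] := eqVneq (r (inord 2) 0) 0; last first.
    apply: aeW => u; apply: ae_imply (pt (- (r 0 0 + r (inord 1) 0 * u) / r (inord 2) 0)) => v.
    apply: contra_not; rewrite /N/= dotE/= -[X in X = 0]addr0 => /(solve _ _ _ _ r20).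
    by rewrite addr0.
  have r10 : r (inord 1) 0 != 0 by case: rn0; rewrite // r20 eqxx.
  apply: ae_imply (pt (- (r 0 0 + 0) / r (inord 1) 0)) => u up.
  apply: aeW => v; apply: contra_not up; rewrite /N/= dotE/= r20 mul0r.
  exact: solve.
rewrite /product_measure1 -[RHS](@integral0 _ _ _ (leb1 R) setT).
apply: ae_eq_integral => //; first exact: measurable_fun_xsection.
apply: ae_imply ae0 => u aeu _ /=.
apply: (@measure_negligible _ _ _ (leb1 R)); first exact: measurable_xsection.
apply: negligibleS aeu => v; rewrite /xsection/= inE => Nuv nN; exact: nN.
Qed.

(** A piecewise continuous function can be replaced by a bounded Borel function
    carried by a square: off the open pieces it only matters on a null set. *)
Lemma integrand_representative (Omega : set (R * R)) (r : 'cV[R]_3) h :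
  open Omega -> bounded_set Omega -> slope_norm r = 1 ->
  bounded_continuous_on Omega h \/ piecewise_continuous_wrt Omega r h ->
  exists (f : R * R -> R) (M D : R),
    [/\ measurable_fun setT f, 0 <= D, forall x, `|f x| <= M,
        forall x, D < `|x.1| \/ D < `|x.2| -> f x = 0 &
        forall k : R * R -> R,
          \int[leb2 R]_(x in Omega) (h x * k x) = \int[leb2 R]_x (f x * k x)].
Proof.
move=> oO bO rn hc.
have mO : measurable Omega by exact: open_measurable_plane.
have [A [mA AO mh [M hM] N0]] : exists A, [/\ measurable A, A `<=` Omega,
    measurable_fun A h, exists M, forall x, A x -> `|h x| <= M &
    leb2 R (Omega `\` A) = 0%E].
  have bnd (B : set (R * R)) : [bounded h x | x in B] -> exists M, forall x, B x -> `|h x| <= M.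
    by move=> [M [_ MB]]; exists (M + 1) => x Bx; apply: (MB (M + 1)) => //; rewrite ltrDl.
  case: hc => [[ch bh]|[[c1 b1] [c2 b2]]].
    exists Omega; split => //; first exact: within_continuous_measurable_plane.
      exact: bnd.
    by rewrite setDv measure0.
  have mneg : measurable [set x : R * R | dot r (hcoord x) < 0].
    rewrite -[X in measurable X]setTI.
    have := @measurable_dot r measurableT `]-oo, 0[%classic (measurable_itv _).
    by congr measurable; apply/seteqP; split => x; rewrite /= in_itv/=.
  have mpos : measurable [set x : R * R | 0 < dot r (hcoord x)].
    rewrite -[X in measurable X]setTI.
    have := @measurable_dot r measurableT `]0, +oo[%classic (measurable_itv _).
    by congr measurable; apply/seteqP; split => x; rewrite /= in_itv/= andbT.
  have m1 := measurableI _ _ mO mneg; have m2 := measurableI _ _ mO mpos.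
  exists ((Omega `&` [set x | dot r (hcoord x) < 0]) `|`
          (Omega `&` [set x | 0 < dot r (hcoord x)])); split.
  - exact: measurableU.
  - by move=> x [[]|[]].
  - by apply/measurable_funU => //; split; exact: within_continuous_measurable_plane.
  - have [M1 h1] := bnd _ b1; have [M2 h2] := bnd _ b2.
    by exists (Num.max M1 M2) => x [/h1|/h2] hx; rewrite le_max hx ?orbT.
  - have [mN N0] := line_null rn.
    apply: (@measure_negligible _ _ _ (leb2 R)).
      by apply: measurableD => //; exact: measurableU.
    exists [set x | dot r (hcoord x) = 0]; split => //.
    move=> x [Ox /not_orP[/not_andP[//|n1] /not_andP[//|n2]]] /=.
    by apply/eqP; move: n1 n2 => /= /negP n1 /negP n2; rewrite eq_le !leNgt n1 n2.
have [D0 [_ OD]] := bO.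
pose D := Num.max 0 (D0 + 1).
have OxD x : Omega x -> `|x.1| <= D /\ `|x.2| <= D.
  have h1 : D0 < D0 + 1 by rewrite ltrDl.
  move=> Ox; have /= := OD _ h1 x Ox.
  by rewrite prod_normE ge_max /D !le_max => /andP[-> ->]; rewrite !orbT.
exists (h \_ A), (Num.max 0 M), D; split.
- by apply/measurable_restrict => //; rewrite setTI.
- by rewrite le_max lexx.
- move=> x; rewrite patchE; case: ifPn; last by rewrite normr0 le_max lexx.
  by rewrite inE => /hM hx; rewrite le_max hx orbT.
- move=> x xD; rewrite patchE; case: ifPn => //; rewrite inE => /AO/OxD[x1 x2].
  by case: xD; rewrite ltNge ?x1 ?x2.
- move=> k; rewrite Rintegral_mkcond.
  apply: (@Rintegral_off_null _ _ _ (leb2 R) (Omega `\` A)) => //.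
    exact: measurableD.
  move=> x nN; rewrite !patchE; have [xA|xA] := boolP (x \in A).
    by rewrite mem_set//; apply: AO; rewrite inE in xA.
  rewrite mul0r; case: ifPn => // xO; exfalso; apply: nN; split.
    by rewrite inE in xO.
  by rewrite notin_setE in xA.
Qed.

End Plane.

(** * Limits of the approximate delta integrals in the plane *)

Lemma open_nonzero_params (R : realType) (r : 'cV[R]_3) (i : 'I_3) :
  open (nonzero_params r i).
Proof.
have [/existsP[j /andP[ji rj]]|/existsPn rji] :=
    boolP [exists j, (j != i) && (r j 0 != 0)].
  rewrite (_ : nonzero_params r i = setT); first exact: openT.
  apply/seteqP; split => // t _; apply/eqP => /matrixP/(_ j 0) /eqP.
  by rewrite !mxE (negbTE ji) (negbTE rj).
rewrite (_ : nonzero_params r i = ~` [set 0]).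
  rewrite openC; apply: accessible_closed_set1; apply: hausdorff_accessible.
  exact: norm_hausdorff.
apply/seteqP; split => t /=.
  move=> st0 t0; move/eqP: st0; apply; apply/matrixP => j k; rewrite !mxE t0.
  case: ifPn => // ji; have := rji j; rewrite ji/= negbK => /eqP rj0.
  exact: rj0.
by move=> t0; apply/eqP => /matrixP/(_ i 0); rewrite !mxE eqxx.
Qed.

Section BoundedPlanarDensity.
Context {R : realType}.
Variables (f : R * R -> R) (M D : R).
Hypothesis mf : measurable_fun setT f.
Hypothesis D0 : 0 <= D.
Hypothesis fM : forall x, `|f x| <= M.
Hypothesis f0 : forall x, D < `|x.1| \/ D < `|x.2| -> f x = 0.

Let M0 : 0 <= M. Proof. exact: le_trans (fM (0, 0)). Qed.

Let box (u : R) : R := \1_(`[- D, D]%classic : set R) u.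

Let integrable_box (B : R) : (leb1 R).-integrable setT (EFin \o (fun u => B * box u)).
Proof.
by have := integrableZl measurableT B (integrable_indic_itv (- D) D true false).
Qed.

Let integrable_box1 : (leb1 R).-integrable setT (EFin \o box).
Proof. exact: integrable_indic_itv. Qed.

Let le_box (g : R * R -> R) (B : R) :
  (forall x, `|x.1| <= D -> `|x.2| <= D -> `|g x| <= B) ->
  forall u v, `|f (u, v) * g (u, v)| <= (M * B) * box u * box v.
Proof.
move=> gB u v; rewrite /box !indicE !mem_setE !in_itv/= -!ler_norml.
have B0 : 0 <= B by apply: le_trans (gB (0, 0) _ _); rewrite ?normr0.
have [uD|uD] := leP `|u| D; last by rewrite f0 ?mul0r ?normr0 ?mulr0 ?mul0r//; left.
have [vD|vD] := leP `|v| D; last by rewrite f0 ?mul0r ?normr0 ?mulr0//; right.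
by rewrite !mulr1 normrM ler_pM// gB.
Qed.

Let mpair (g : R * R -> R) : measurable_fun setT g ->
  measurable_fun setT (fun z : R * R => (fun u v => g (u, v)) z.1 z.2).
Proof. by move=> mg; apply: (eq_measurable_fun g) => // -[]. Qed.

Lemma integrable_planar (g : R * R -> R) (B : R) : measurable_fun setT g ->
  (forall x, `|x.1| <= D -> `|x.2| <= D -> `|g x| <= B) ->
  (leb2 R).-integrable setT (EFin \o (fun x => f x * g x)).
Proof.
move=> mg gB; have mfg := mpair (measurable_funM mf mg).
have := integrable_prod_bound (mu := leb1 R) (nu := leb1 R)
  (f := fun u v => f (u, v) * g (u, v)) mfg (integrable_box (M * B)) integrable_box1
  (le_box gB).
by apply: eq_integrable => // -[].
Qed.

Lemma planar_iterated (g : R * R -> R) (B : R) : measurable_fun setT g ->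
  (forall x, `|x.1| <= D -> `|x.2| <= D -> `|g x| <= B) ->
  \int[leb2 R]_x (f x * g x) = \int[leb1 R]_u \int[leb1 R]_v (f (u, v) * g (u, v)) /\
  \int[leb2 R]_x (f x * g x) = \int[leb1 R]_v \int[leb1 R]_u (f (u, v) * g (u, v)).
Proof.
move=> mg gB; have mfg := mpair (measurable_funM mf mg).
have E1 := Rintegral_prod (mu := leb1 R) (nu := leb1 R)
  (f := fun u v => f (u, v) * g (u, v)) mfg (integrable_box (M * B)) integrable_box1
  (le_box gB).
have E2 := Rfubini (mu := leb1 R) (nu := leb1 R)
  (f := fun u v => f (u, v) * g (u, v)) mfg (integrable_box (M * B)) integrable_box1
  (le_box gB).
have E0 : \int[leb2 R]_x (f x * g x) =
    \int[leb2 R]_z (f (z.1, z.2) * g (z.1, z.2)) by apply: eq_Rintegral => -[].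
by split; [exact: etrans E0 E1|exact: etrans (etrans E0 E1) E2].
Qed.

Section OneComponent.
Variables (r : 'cV[R]_3) (i : 'I_3).

Let c (x : R * R) : R := dot (subst_comp r i 0) (hcoord x).
Let y (x : R * R) : R := hcoord x i 0.

Lemma hcoord_le x : `|x.1| <= D -> `|x.2| <= D -> `|y x| <= 1 + D.
Proof.
move=> x1 x2; rewrite /y; have D1 : 1 <= 1 + D by rewrite lerDl.
case: (ord3P i) => ->; rewrite hcoordE ?normr1//.
- by rewrite (le_trans x1)// lerDr.
- by rewrite (le_trans x2)// lerDr.
Qed.

Lemma dot_le (w : 'cV[R]_3) x : `|x.1| <= D -> `|x.2| <= D ->
  `|dot w (hcoord x)| <= `|w 0 0| + `|w (inord 1) 0| * D + `|w (inord 2) 0| * D.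
Proof.
move=> x1 x2; rewrite dotE (le_trans (ler_normD _ _))// lerD//.
  by rewrite (le_trans (ler_normD _ _))// lerD// normrM ler_wpM2l.
by rewrite normrM ler_wpM2l.
Qed.

Lemma planar_delta_iterated (s t : R) :
  \int[leb2 R]_x (f x * y x * delta_approx s (c x + t * y x)) =
    \int[leb1 R]_u \int[leb1 R]_v
      (f (u, v) * y (u, v) * delta_approx s (c (u, v) + t * y (u, v))) /\
  \int[leb2 R]_x (f x * y x * delta_approx s (c x + t * y x)) =
    \int[leb1 R]_v \int[leb1 R]_u
      (f (u, v) * y (u, v) * delta_approx s (c (u, v) + t * y (u, v))).
Proof.
have mz : measurable_fun setT (fun x : R * R => c x + t * y x).
  by apply: measurable_funD; [exact: measurable_dot|apply: measurable_funM => //; exact: measurable_hcoord].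
have md := measurableT_comp (measurable_delta_approx s) mz.
have [||E1 E2] := @planar_iterated (fun x => y x * delta_approx s (c x + t * y x))
    ((1 + D) * `|(2 * s)^-1|).
- by apply: measurable_funM => //; exact: measurable_hcoord.
- move=> x x1 x2; rewrite normrM ler_pM ?hcoord_le// delta_approx_norm.
  by case: ifP => // _; rewrite normr0.
- by split; [rewrite -[RHS]/_; move: E1|move: E2]; under eq_Rintegral do rewrite mulrA;
    move=> ->; apply: eq_Rintegral => u _; apply: eq_Rintegral => v _; rewrite mulrA.
Qed.

Let good (U : set R) (A A' : R -> R -> R) : ae_cvg_locally_bounded U A' -> A = A' ->
  forall V, V `<=` U -> ae_cvg_locally_bounded V A.
Proof.
move=> [h1 h2] -> V VU; split => // K cK KV.
by apply: h2 => //; exact: subset_trans VU.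
Qed.

(** The inner variable is a coordinate whose slope is nonzero and does not depend
    on [t]; then the strips are transverse. If there is none, [i] is the index of
    a slope and the other slope is 0, so that the lines are parallel to an axis. *)
Lemma delta_limits_ae : slope_norm r = 1 ->
  ae_cvg_locally_bounded (nonzero_params r i)
    (fun s t => \int[leb2 R]_x (f x * y x * delta_approx s (c x + t * y x))).
Proof.
move=> /slope_neq0 rn0.
pose w0 := r 0 0; pose w1 := r (inord 1) 0; pose w2 := r (inord 2) 0.
have mf1 : measurable_fun setT (fun z : R * R => (fun u v => f (u, v)) z.1 z.2).
  exact: mpair.
have mf2 : measurable_fun setT (fun z : R * R => (fun u v => f (v, u)) z.1 z.2).
  apply: (measurableT_comp mf (g := fun z : R * R => (z.2, z.1))).
  exact: measurable_fun_pair.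
have f01 (u v : R) : D < `|u| \/ D < `|v| -> f (u, v) = 0.
  by move=> h; apply: f0.
have f02 (u v : R) : D < `|u| \/ D < `|v| -> f (v, u) = 0.
  by move=> h; apply: f0; case: h; [right|left].
have T1 := transverse_strips (f := fun u v => f (u, v)) (M := M) mf1 (fun u v => fM (u, v)) f01.
have T2 := transverse_strips (f := fun u v => f (v, u)) (M := M) mf2 (fun u v => fM (v, u)) f02.
have P1 := parallel_strips (f := fun u v => f (u, v)) (M := M) mf1 D0 (fun u v => fM (u, v)) f01.
have P2 := parallel_strips (f := fun u v => f (v, u)) (M := M) mf2 D0 (fun u v => fM (v, u)) f02.
have ae1 : {ae leb1 R, forall u : R, (1 : R) != 0} by apply: aeW => _; exact: oner_neq0.
have aeid := @ae_neq R 0.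
have i1 (g g' : R -> R -> R) : (forall u v, g u v = g' u v) ->
    \int[leb1 R]_u \int[leb1 R]_v g u v = \int[leb1 R]_u \int[leb1 R]_v g' u v.
  by move=> gg; apply: eq_Rintegral => u _; apply: eq_Rintegral => v _.
have mlin (a : R) : measurable_fun setT (fun u : R => a * u) by exact: measurable_funM.
have cst1_le (u : R) : `|u| <= D -> `|cst (1 : R) u| <= (1 : R) by rewrite normr1.
have inner2 (A' : R -> R -> R) (U : set R) : ae_cvg_locally_bounded U A' -> nonzero_params r i `<=` U ->
    (forall s t, \int[leb1 R]_u \int[leb1 R]_v
      (f (u, v) * y (u, v) * delta_approx s (c (u, v) + t * y (u, v))) = A' s t) ->
    ae_cvg_locally_bounded (nonzero_params r i)
      (fun s t => \int[leb2 R]_x (f x * y x * delta_approx s (c x + t * y x))).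
  move=> gA' UV E; apply: (good gA' _ UV); apply/funext => s; apply/funext => t.
  exact: etrans (proj1 (planar_delta_iterated s t)) (E s t).
have inner1 (A' : R -> R -> R) (U : set R) : ae_cvg_locally_bounded U A' -> nonzero_params r i `<=` U ->
    (forall s t, \int[leb1 R]_v \int[leb1 R]_u
      (f (u, v) * y (u, v) * delta_approx s (c (u, v) + t * y (u, v))) = A' s t) ->
    ae_cvg_locally_bounded (nonzero_params r i)
      (fun s t => \int[leb2 R]_x (f x * y x * delta_approx s (c x + t * y x))).
  move=> gA' UV E; apply: (good gA' _ UV); apply/funext => s; apply/funext => t.
  exact: etrans (proj2 (planar_delta_iterated s t)) (E s t).
have sT : nonzero_params r i `<=` setT by [].
(* parallel strips occur for i = j when the other slope, of index k, vanishes *)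
have degenerate (j k : 'I_3) : i = j -> (forall l, [\/ l = 0, l = j | l = k]) ->
    r k 0 = 0 -> nonzero_params r i `<=` [set t | t != 0 \/ w0 != 0].
  move=> -> jk rk0 t; rewrite /nonzero_params/= => st0.
  have [t0|] := eqVneq t 0; last by left.
  have [w00|] := eqVneq w0 0; last by right.
  exfalso; move/eqP: st0; apply; apply/matrixP => l n; rewrite !mxE.
  case: ifPn => // lj; case: (jk l) => [->|lE|->] //.
  by rewrite lE eqxx in lj.
case: (ord3P i) => iE.
- have [w20|w20] := eqVneq w2 0.
    have w10 : w1 != 0 by case: rn0 => //; rewrite -/w2 w20 eqxx.
    have T := T2 _ _ w1 1 (mlin w2) (measurable_cst (1 : R)) w10 ae1 ler01 cst1_le.
    apply: (inner1 _ _ T sT).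
    move=> s t; apply: i1 => u v; rewrite /c /y dotE iE hcoordE !mxE !inord3_neq eqxx /=.
    by congr (_ * _ * delta_approx _ _); rewrite /w1 /w2; ring.
  have T := T1 _ _ w2 1 (mlin w1) (measurable_cst (1 : R)) w20 ae1 ler01 cst1_le.
  apply: (inner2 _ _ T sT).
  move=> s t; apply: i1 => u v; rewrite /c /y dotE iE hcoordE !mxE !inord3_neq eqxx /=.
  by congr (_ * _ * delta_approx _ _); rewrite /w1 /w2; ring.
- have [w20|w20] := eqVneq w2 0.
    apply: (inner1 _ _ (P2 w0)).
      by apply: (degenerate _ (inord 2) iE _ w20); exact: ord3P.
    move=> s t; apply: i1 => u v; rewrite /c /y dotE iE hcoordE !mxE !inord3_neq eqxx /=.
    by congr (_ * _ * delta_approx _ _); rewrite -/w2 w20 /w0; ring.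
  have T := T1 _ _ w2 D (measurable_cst w0) (@measurable_id _ R setT)
    w20 aeid D0 (fun u uD => uD).
  apply: (inner2 _ _ T sT).
  move=> s t; apply: i1 => u v; rewrite /c /y dotE iE hcoordE !mxE !inord3_neq eqxx /=.
  by congr (_ * _ * delta_approx _ _); rewrite /w0 /w2; ring.
- have [w10|w10] := eqVneq w1 0.
    apply: (inner2 _ _ (P1 w0)).
      by apply: (degenerate _ (inord 1) iE _ w10) => l; case: (ord3P l); [exact: Or31|exact: Or33|exact: Or32].
    move=> s t; apply: i1 => u v; rewrite /c /y dotE iE hcoordE !mxE !inord3_neq eqxx /=.
    by congr (_ * _ * delta_approx _ _); rewrite -/w1 w10 /w0; ring.
  have T := T2 _ _ w1 D (measurable_cst w0) (@measurable_id _ R setT)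
    w10 aeid D0 (fun u uD => uD).
  apply: (inner1 _ _ T sT).
  move=> s t; apply: i1 => u v; rewrite /c /y dotE iE hcoordE !mxE !inord3_neq eqxx /=.
  by congr (_ * _ * delta_approx _ _); rewrite /w0 /w1; ring.
Qed.

End OneComponent.
End BoundedPlanarDensity.

(** * The gradient identities *)

(** Lebesgue measure on the plane under its own name, so that it can carry a
    sigma-finite measure structure. *)
Definition plane_measure (R : realType) :
  set (measurableTypeR R * measurableTypeR R) -> \bar R := leb2 R.

HB.instance Definition _ (R : realType) :=
  Measure.copy (@plane_measure R) (leb2 R).

Lemma plane_measure_sigma_finite (R : realType) :
  sigma_finite setT (@plane_measure R).
Proof.
exists (fun n => ball (0 : R) n%:R `*` ball (0 : R) n%:R).
  apply/esym; apply/seteqP; split => // x _.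
  have x0 : 0 <= `|x.1| + `|x.2| by rewrite addr_ge0.
  have /andP[_ xn] := truncn_itv x0.
  by exists (Num.trunc (`|x.1| + `|x.2|)).+1 => //; split; rewrite -ball_normE/=
    sub0r normrN (le_lt_trans _ xn)// ?lerDl ?lerDr.
move=> n; split; first by apply: measurableX; exact: measurable_ball.
rewrite /plane_measure product_measure1E; [|exact: measurable_ball|exact: measurable_ball].
have bn := @lebesgue_measure_ball R 0 n%:R (ler0n _ _).
by have := ltry ((n%:R *+ 2) * (n%:R *+ 2) : R); rewrite EFinM -bn.
Qed.

HB.instance Definition _ (R : realType) :=
  Measure_isSigmaFinite.Build _ _ _ (@plane_measure R) (@plane_measure_sigma_finite R).

Theorem lemma3p2 (R : realType) (Omega : set (R * R)) (rhat rtilde : 'cV[R]_3)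
    (h : R * R -> R)
    (Omega_open : open Omega) (Omega_connected : connected Omega)
    (Omega_bounded : bounded_set Omega)
    (rhat_unit : slope_norm rhat = 1) (rtilde_unit : slope_norm rtilde = 1)
    (lines_distinct : breaking_line Omega rhat <> breaking_line Omega rtilde)
    (rhat_line_nonempty : breaking_line Omega rhat !=set0)
    (h_cont : bounded_continuous_on Omega h \/
              piecewise_continuous_wrt Omega rtilde h) :
  forall i : 'I_3,
  let rt := subst_comp rhat i in
  (* first identity, tested against every element of C_0^infty(R) *)
  (forall phi : R -> R, test_function setT phi ->
     let Dphi := dist_deriv
       (fun t => \int[leb2 R]_(x in Omega) (h x * heaviside (dot (rt t) (hcoord x))))
       phi in
     (\int[leb1 R]_(t in setT)
        (delta_approx_int Omega (fun x => h x * hcoord x i 0) (rt t) s * phi t))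
       @[s --> 0^'+] --> Dphi /\
     Dphi = \int[leb2 R]_(x in Omega)
       (h x * dist_deriv (fun t => heaviside (dot (rt t) (hcoord x))) phi)) /\
  (* first identity, between functions *)
  (exists G : R -> R,
     {ae leb1 R, forall t,
        is_delta_int Omega (fun x => h x * hcoord x i 0) (rt t) (G t)} /\
     is_weak_deriv (nonzero_params rhat i)
       (fun t => \int[leb2 R]_(x in Omega) (h x * heaviside (dot (rt t) (hcoord x))))
       G) /\
  (* second identity *)
  (exists G : R -> R,
     {ae leb1 R, forall t,
        is_delta_int Omega
          (fun x => h x * relu (dot (rt t) (hcoord x)) * hcoord x i 0)
          (rt t) (G t)} /\
     is_weak_deriv setT
       (fun t => \int[leb2 R]_(x in Omega)
          (h x * relu (dot (rt t) (hcoord x)) * heaviside (dot (rt t) (hcoord x))))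
       (fun t => G t + \int[leb2 R]_(x in Omega)
          (h x * heaviside (dot (rt t) (hcoord x)) ^+ 2 * hcoord x i 0))).
Proof.
move=> i rt.
have [f [M [D [mf D0 fM f0 hf]]]] :=
  integrand_representative Omega_open Omega_bounded rtilde_unit h_cont.
pose mu : {sigma_finite_measure set (measurableTypeR R * measurableTypeR R)%type -> \bar R} :=
  @plane_measure R.
have {}hf k : \int[leb2 R]_(x in Omega) (h x * k x) = \int[mu]_x (f x * k x) by exact: hf.
pose c (x : R * R) : R := dot (subst_comp rhat i 0) (hcoord x).
pose y (x : R * R) : R := hcoord x i 0.
have dE t x : dot (rt t) (hcoord x) = c x + t * y x by exact: dot_subst_comp.
have mc : measurable_fun setT c by exact: measurable_dot.
have my : measurable_fun setT y by exact: measurable_hcoord.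
have intf : mu.-integrable setT (EFin \o f).
  have b1 (x : R * R) : `|x.1| <= D -> `|x.2| <= D -> `|cst (1 : R) x| <= (1 : R).
    by rewrite normr1.
  have := integrable_planar mf D0 fM f0 (measurable_cst (1 : R)) b1.
  by apply: eq_integrable => // x _ /=; rewrite mulr1.
have intfc : mu.-integrable setT (EFin \o (fun x => f x * c x)).
  exact: (integrable_planar mf D0 fM f0 mc (fun x x1 x2 => dot_le _ x1 x2)).
have intfy : mu.-integrable setT (EFin \o (fun x => f x * y x)).
  exact: (integrable_planar mf D0 fM f0 my (fun x x1 x2 => hcoord_le D0 i x1 x2)).
have HE : (fun t => \int[leb2 R]_(x in Omega) (h x * heaviside (dot (rt t) (hcoord x)))) =
    (fun t => \int[mu]_x (f x * heaviside (c x + t * y x))).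
  by apply/funext => t; rewrite hf; apply: eq_Rintegral => x _; rewrite dE.
have RE : (fun t => \int[leb2 R]_(x in Omega)
      (h x * relu (dot (rt t) (hcoord x)) * heaviside (dot (rt t) (hcoord x)))) =
    (fun t => \int[mu]_x (f x * relu (c x + t * y x) * heaviside (c x + t * y x))).
  apply/funext => t; under eq_Rintegral do rewrite -mulrA.
  by rewrite hf; apply: eq_Rintegral => x _; rewrite dE mulrA.
have H2E t : \int[leb2 R]_(x in Omega)
      (h x * heaviside (dot (rt t) (hcoord x)) ^+ 2 * hcoord x i 0) =
    \int[mu]_x (f x * heaviside (c x + t * y x) ^+ 2 * y x).
  under eq_Rintegral do rewrite -mulrA.
  by rewrite hf; apply: eq_Rintegral => x _; rewrite dE mulrA.
have AE s t : delta_approx_int Omega (fun x => h x * hcoord x i 0) (rt t) s =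
    \int[mu]_x (f x * y x * delta_approx s (c x + t * y x)).
  rewrite /delta_approx_int; under eq_Rintegral do rewrite -mulrA.
  by rewrite hf; apply: eq_Rintegral => x _; rewrite dE mulrA.
have RAE s t : delta_approx_int Omega
      (fun x => h x * relu (dot (rt t) (hcoord x)) * hcoord x i 0) (rt t) s =
    \int[mu]_x (f x * relu (c x + t * y x) * y x * delta_approx s (c x + t * y x)).
  rewrite /delta_approx_int; under eq_Rintegral do rewrite -2!mulrA.
  by rewrite hf; apply: eq_Rintegral => x _; rewrite dE !mulrA.
split; [|split].
- move=> phi tphi Dphi; split.
    rewrite /Dphi HE.
    rewrite (_ : (fun s => \int[leb1 R]_(t in setT) _) = (fun s => \int[leb1 R]_t
        ((\int[mu]_x (f x * y x * delta_approx s (c x + t * y x))) * phi t))); last first.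
      by apply/funext => s; apply: eq_Rintegral => t _; rewrite AE.
    exact: (cvg_dist_delta_approx intf mc my intfy tphi).
  rewrite /Dphi HE (dist_deriv_heaviside intf mc my tphi) hf.
  apply: eq_Rintegral => x _; congr (_ * dist_deriv _ _).
  by apply/funext => t; rewrite dE.
- have [aeA bA] := delta_limits_ae mf D0 fM f0 i rhat_unit.
  pose A s t := \int[mu]_x (f x * y x * delta_approx s (c x + t * y x)).
  (* an upper limit along a sequence of radii is measurable in t *)
  pose G t : R := fine (limn_esup (fun n => (A n.+1%:R^-1 t)%:E)).
  have mG : measurable_fun setT G.
    apply: measurableT_comp; first exact: fine_measurable.
    apply: measurable_fun_limn_esup => n; apply/measurable_EFinP.
    exact: (measurable_int_delta_approx intf mc my).
  have aeG : {ae leb1 R, forall t, A s t @[s --> 0^'+] --> G t}.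
    apply: ae_imply aeA => t [l Al].
    suff -> : G t = l by exact: Al.
    have cs : (A n.+1%:R^-1 t)%:E @[n --> \oo] --> l%:E.
      apply/fine_cvgP; split; first exact: nearW.
      move/cvg_at_rightP : Al; apply; split; last exact: cvg_harmonic.
      by move=> n; rewrite invr_gt0.
    by rewrite /G is_cvg_limn_esupE ?(cvg_lim _ cs)//; apply/cvg_ex; exists l%:E.
  exists G; split.
    apply: ae_imply aeG => t; rewrite /is_delta_int.
    by under [X in _ -> X @ _ --> _]eq_fun do rewrite AE.
  rewrite HE; apply: (is_weak_deriv_of_ae_cvg intf mc my intfy) => //.
  exact: open_nonzero_params.
(* the delta term of the second identity is 0 for every t *)
- exists (cst 0); split.
    apply: aeW => t; rewrite /is_delta_int; under eq_fun do rewrite RAE.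
    exact: (cvg_relu_delta_approx intf mc my intfy).
  rewrite RE; split.
  + by apply: (locally_integrable_int_relu intf mc my intfc intfy); exact: openT.
  + under eq_fun do rewrite add0r H2E.
    by apply: (locally_integrable_int_heaviside2 intf mc my intfy); exact: openT.
  + move=> phi tphi; under [RHS]eq_Rintegral do rewrite add0r H2E.
    exact: (dist_deriv_relu intf mc my intfc intfy tphi).
Qed.
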